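(* Let $W$ be a finite real reflection group acting on $V$, with root system $R$, simple roots $\alpha_1,\ldots,\alpha_n$, corresponding simple reflections $s_1,\ldots,s_n$, and let $k_\alpha\in\mathbb{C}$ ($\alpha\in R$) satisfy $k_{w\alpha}=k_\alpha$ for all $w\in W$, $\alpha\in R$. For $v\in V$ put $$\langle v,h\rangle=\tfrac12\sum_{\alpha>0}k_\alpha\langle v,\alpha^\vee\rangle t_{s_\alpha}\in\mathbb{C}W,$$ and let $A$ be the associative algebra generated by $V$ and $\mathbb{C}W$ with the additional relations $$t_gv=(gv)t_g\qquad\text{and}\qquad [v,w]=-[\langle v,h\rangle,\langle w,h\rangle],\qquad v,w\in V,\ g\in W.$$ Then: (a) As vector spaces, $A\cong S(V)\otimes\mathbb{C}W$ (and hence $A$ is a graded Hecke algebra for $W$). (b) If $\tilde v=v-\langle v,h\rangle\in A$ for $v\in V$, then $$[\tilde v,\tilde w]=0\qquad\text{and}\qquad t_{s_i}\tilde v=(\widetilde{s_iv})\,t_{s_i}-k_{\alpha_i}\langle v,\alpha_i^\vee\rangle$$ for all $v,w\in V$ and all simple reflections $s_i$ in $W$.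
   Context: $V=\mathbb{C}\otimes_{\mathbb{R}}V_{\mathbb{R}}$ with $W\subseteq GL(V_{\mathbb{R}})$ a finite group generated by reflections; $\langle\,,\rangle$ is a $W$-invariant inner product on $V_{\mathbb{R}}$, extended bilinearly to $V$ (all roots lie in $V_{\mathbb{R}}$). The root system $R$ contains exactly the two roots $\pm\alpha$ for each reflection $s_\alpha$ of $W$, is $W$-stable, and $$s_\alpha v=v-\langle v,\alpha^\vee\rangle\alpha,\qquad \alpha^\vee=2\alpha/\langle\alpha,\alpha\rangle.$$ $\alpha>0$ means that $\alpha$ is a positive root with respect to the simple roots $\alpha_1,\dots,\alpha_n$. $\mathbb{C}W$ is the group algebra with basis $\{t_g\mid g\in W\}$, $t_gt_h=t_{gh}$; $[x,y]=xy-yx$; $S(V)$ is the symmetric algebra of $V$. Graded Hecke algebras. For a finite subgroup $G\subseteq GL(V)$ and skew symmetric bilinear forms $a_g\colon V\times V\to\mathbb{C}$ ($g\in G$), consider the associative algebra $A$ generated by $V$ and $\mathbb{C}G$ with relations $t_hvt_{h^{-1}}=hv$ and $[v,w]=\sum_{g\in G}a_g(v,w)t_g$ for $h\in G$, $v,w\in V$. Every $a\in A$ can be written $a=\sum_gp_gt_g$ with $p_g\in S(V)$ (lifted by a fixed section of $T(V)\to S(V)$, e.g. ordered monomials in a basis of $V$). $A$ is a graded Hecke algebra for $G$ if $A\cong S(V)\otimes\mathbb{C}G$ as a vector space, in the sense that this expression is unique: for a basis $u_1,\dots,u_m$ of $V$, the elements $u_1^{m_1}\cdots u_m^{m_m}t_g$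 ($m_i\ge0$, $g\in G$) form a basis of $A$. The vector space isomorphism in (a) is meant in this sense. (The algebra $A$ of the theorem is of this form, with $a_g(v,w)$ the coefficient of $t_g$ in $-[\langle v,h\rangle,\langle w,h\rangle]$.) *)

(* Defs.v *)
From HB Require Import structures.
From mathcomp Require Import all_boot all_order all_algebra all_fingroup.
From mathcomp Require Import mxrepresentation generic_quotient ring_quotient.
From mathcomp Require Import finmap monalg.
From mathcomp Require Import boolp reals complex.

Set Implicit Arguments.
Unset Strict Implicit.
Unset Printing Implicit Defensive.

Import GRing.Theory Num.Theory.
Local Open Scope ring_scope.
Local Open Scope quotient_scope.

Section GroupAlgebra.
Variables (K : fieldType) (gT : finGroupType).

Definition grpalg : Type := {ffun gT -> K}.

HB.instance Definition _ := GRing.Lmodule.copy grpalg {ffun gT -> K^o}.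

Implicit Types x y z : grpalg.

Definition gbase (g : gT) : grpalg := [ffun h => (h == g)%:R].

(* convolution, not the pointwise product that finite functions carry *)
Definition gmul x y : grpalg := [ffun g => \sum_h x h * y (h^-1 * g)%g].

Let gmulA : associative gmul.
Proof.
move=> x y z; apply/ffunP=> g; rewrite !ffunE.
under eq_bigr => h _ do rewrite ffunE mulr_sumr.
under [RHS]eq_bigr => h _ do rewrite ffunE mulr_suml.
rewrite exchange_big [RHS]exchange_big /= exchange_big /=.
apply: eq_bigr => h _; rewrite (reindex_inj (mulgI h^-1)%g) /=.
by apply: eq_bigr => j _; rewrite mulrA invMg invgK -!mulgA mulKVg.
Qed.

Let gmul1l : left_id (gbase 1%g) gmul.
Proof.
move=> x; apply/ffunP=> g; rewrite ffunE (bigD1 1%g) //= ffunE eqxx mul1r.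
rewrite invg1 mul1g big1 ?addr0 // => h /negPf hn.
by rewrite ffunE hn mul0r.
Qed.

Let gmul1r : right_id (gbase 1%g) gmul.
Proof.
move=> x; apply/ffunP=> g; rewrite ffunE (bigD1 g) //= ffunE mulVg eqxx mulr1.
rewrite big1 ?addr0 // => h hn; rewrite ffunE -eq_mulVg1.
by rewrite (negPf hn) mulr0.
Qed.

Let gmulDl : left_distributive gmul +%R.
Proof.
move=> x y z; apply/ffunP=> g; rewrite !ffunE -big_split /=.
by apply: eq_bigr => h _; rewrite ffunE mulrDl.
Qed.

Let gmulDr : right_distributive gmul +%R.
Proof.
move=> x y z; apply/ffunP=> g; rewrite !ffunE -big_split /=.
by apply: eq_bigr => h _; rewrite ffunE mulrDr.
Qed.

Let gone_neq0 : gbase 1%g != 0.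
Proof.
apply/eqP => /ffunP /(_ 1%g); rewrite !ffunE eqxx.
by apply/eqP; exact: oner_neq0.
Qed.

HB.instance Definition _ :=
  GRing.Zmodule_isNzRing.Build grpalg gmulA gmul1l gmul1r gmulDl gmulDr gone_neq0.

Lemma gbaseM g h : gbase g * gbase h = gbase (g * h)%g.
Proof.
apply/ffunP => j; rewrite ffunE (bigD1 g) //= !ffunE eqxx mul1r.
rewrite big1 ?addr0 => [|i /negPf ig]; last by rewrite ffunE ig mul0r.
by rewrite -(inj_eq (mulgI g)) mulKVg.
Qed.

End GroupAlgebra.

Arguments gbase {K gT} g.

Section PresentedAlgebra.
Variables (K : fieldType) (X : choiceType).

Local Notation F := {malg K[{fmonom X}]}.

Inductive ideal_gen (rel : F -> Prop) : F -> Prop :=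
| IdealGen x of rel x : ideal_gen rel x
| Ideal0 : ideal_gen rel 0
| IdealB x y of ideal_gen rel x & ideal_gen rel y : ideal_gen rel (x - y)
| IdealMl a x of ideal_gen rel x : ideal_gen rel (a * x)
| IdealMr x a of ideal_gen rel x : ideal_gen rel (x * a).

Variable rel : F -> Prop.

Definition ideal_pred : {pred F} := fun x => `[< ideal_gen rel x >].

Let ideal_zmod_closed : zmod_closed ideal_pred.
Proof.
split=> [|x y]; first by apply/asboolP; exact: Ideal0.
by move=> /asboolP xI /asboolP yI; apply/asboolP; exact: IdealB.
Qed.

HB.instance Definition _ := GRing.isZmodClosed.Build F ideal_pred ideal_zmod_closed.

Definition presalg : Type := Quotient.quot ideal_pred.

HB.instance Definition _ := GRing.Zmodule.on presalg.
HB.instance Definition _ := EqQuotient.on presalg.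

Local Notation "\q x" := (\pi_presalg x) (at level 0).

Definition pmul := lift_op2 presalg *%R.
Definition pscale (c : K) := lift_op1 presalg ( *:%R c).

Lemma presalg_eqP (x y : F) : reflect (ideal_gen rel (x - y)) (\q x == \q y).
Proof.
rewrite -[_ == _](@Quotient.idealrBE F ideal_pred).
exact: asboolP.
Qed.

Let pi_repr (x : F) : ideal_gen rel (repr \q x - x).
Proof. by apply/presalg_eqP; rewrite reprK. Qed.

Let pi0 : \q 0 = 0.
Proof. exact: (@pi_zeror _ _ _ _ _ (Quotient.quot ideal_pred)). Qed.

Let piD x y : \q (x + y) = \q x + \q y.
Proof. exact: (@pi_addr _ _ _ _ _ (Quotient.quot ideal_pred)). Qed.

Let ideal_genD x y : ideal_gen rel x -> ideal_gen rel y -> ideal_gen rel (x + y).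
Proof.
move=> xI yI; rewrite -[y]opprK -[- y]sub0r.
exact: IdealB xI (IdealB (Ideal0 _) yI).
Qed.

Let piM x y : \q (x * y) = pmul \q x \q y.
Proof.
rewrite /pmul -lock; apply/esym/eqP/presalg_eqP.
rewrite -[repr _ * _](subrK (repr \q x * y)) -addrA -mulrBr -mulrBl.
by apply: ideal_genD; [apply: IdealMl|apply: IdealMr]; exact: pi_repr.
Qed.

Let piZ c x : \q (c *: x) = pscale c \q x.
Proof.
rewrite /pscale -lock; apply/esym/eqP/presalg_eqP; rewrite -scalerBr -[_ - x]mul1r scalerAl.
by apply: IdealMl; exact: pi_repr.
Qed.

Let pmulA : associative pmul.
Proof. by move=> x y z; rewrite -[x]reprK -[y]reprK -[z]reprK -!piM mulrA. Qed.

Let pmul1l : left_id (\q 1) pmul.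
Proof. by move=> x; rewrite -[x]reprK -piM mul1r. Qed.

Let pmul1r : right_id (\q 1) pmul.
Proof. by move=> x; rewrite -[x]reprK -piM mulr1. Qed.

Let pmulDl : left_distributive pmul +%R.
Proof.
by move=> x y z; rewrite -[x]reprK -[y]reprK -[z]reprK -!piM -!piD -piM mulrDl.
Qed.

Let pmulDr : right_distributive pmul +%R.
Proof.
by move=> x y z; rewrite -[x]reprK -[y]reprK -[z]reprK -!piM -!piD -piM mulrDr.
Qed.

(* A quotient may collapse to 0, so it is only a possibly zero ring, whereas
   algType requires 1 != 0: the algebra structure consists of this ring
   structure, the module structure below and the scaling lemmas. *)
HB.instance Definition _ :=
  GRing.Zmodule_isPzRing.Build presalg pmulA pmul1l pmul1r pmulDl pmulDr.

Let pscaleA a b (x : presalg) : pscale a (pscale b x) = pscale (a * b) x.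
Proof. by rewrite -[x]reprK -!piZ scalerA. Qed.

Let pscale1 : left_id 1 pscale.
Proof. by move=> x; rewrite -[x]reprK -piZ scale1r. Qed.

Let pscaleDr : right_distributive pscale +%R.
Proof. by move=> c x y; rewrite -[x]reprK -[y]reprK -!piZ -!piD -piZ scalerDr. Qed.

Let pscaleDl x : {morph pscale^~ x : a b / a + b}.
Proof. by move=> a b; rewrite -[x]reprK /= -!piZ -piD scalerDl. Qed.

HB.instance Definition _ := GRing.Zmodule_isLmodule.Build K presalg
  pscaleA pscale1 pscaleDr pscaleDl.

Lemma pi_presalg0 : \q 0 = 0. Proof. exact: pi0. Qed.

Lemma pi_presalg1 : \q 1 = 1. Proof. by []. Qed.

Lemma pi_presalgD (x y : F) : \q (x + y) = \q x + \q y. Proof. exact: piD. Qed.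

Lemma pi_presalgM (x y : F) : \q (x * y) = \q x * \q y. Proof. exact: piM. Qed.

Lemma pi_presalgZ (c : K) (x : F) : \q (c *: x) = c *: \q x. Proof. exact: piZ. Qed.

Lemma presalg_relP (x y : F) : rel (x - y) -> \q x = \q y.
Proof. by move=> xy; apply/eqP/presalg_eqP; exact: IdealGen. Qed.

Lemma presalg_scaleAl (c : K) (x y : presalg) : c *: (x * y) = (c *: x) * y.
Proof.
by rewrite -[x]reprK -[y]reprK -[_ * _]piM -[c *: _]piZ -[c *: \q _]piZ
           -[RHS]piM scalerAl.
Qed.

Lemma free_scaleAr (c : K) (x y : F) : c *: (x * y) = x * (c *: y).
Proof.
have xc : x * c%:MP = c *: x.
  rewrite malgM_def malgZ_def fgmulgU; apply/eq_bigr => i _.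
  by rewrite mulm1 mulrC.
by rewrite -(mul_malgC c y) mulrA xc scalerAl.
Qed.

Lemma presalg_scaleAr (c : K) (x y : presalg) : c *: (x * y) = x * (c *: y).
Proof.
by rewrite -[x]reprK -[y]reprK -[_ * _]piM -[c *: _]piZ -[c *: \q _]piZ
           -[RHS]piM free_scaleAr.
Qed.

Definition presgen (x : X) : presalg := \q << fmu x >>.

End PresentedAlgebra.

Arguments presgen {K X} rel x.

Definition comm_br (A : pzRingType) (x y : A) : A := x * y - y * x.

Definition formal_basis (K : fieldType) (A : lmodType K) (I : choiceType)
    (f : I -> A) : Prop :=
  forall a : A, exists! c : {malg K[I]}, a = \sum_(i <- msupp c) c@_i *: f i.

Section HeckeAlgebra.
Variables (K : fieldType) (gT : finGroupType) (m : nat).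
Variable rho : mx_representation K [set: gT] m.
(* kappa v w = \sum_g a_g(v, w) t_g; the forms are a_g(v, w) = kappa v w g *)
Variable kappa : 'cV[K]_m -> 'cV[K]_m -> grpalg K gT.

Local Notation X := ('cV[K]_m + gT)%type.
Local Notation F := {malg K[{fmonom X}]}.
Local Notation V_ v := (<< fmu (inl v : X) >> : F).
Local Notation T_ g := (<< fmu (inr g : X) >> : F).

Inductive hecke_rel : F -> Prop :=
| RelVlin c v w : hecke_rel (V_ (c *: v + w) - (c *: V_ v + V_ w))
| RelT1 : hecke_rel (T_ 1%g - 1)
| RelTM g h : hecke_rel (T_ (g * h)%g - T_ g * T_ h)
| RelTV g v : hecke_rel (T_ g * V_ v - V_ (rho g *m v) * T_ g)
| RelVV v w : hecke_rel (comm_br (V_ v) (V_ w) - \sum_g kappa v w g *: T_ g).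

Definition hecke_alg := presalg hecke_rel.

HB.instance Definition _ := GRing.PzRing.on hecke_alg.
HB.instance Definition _ := GRing.Lmodule.on hecke_alg.

Definition hV (v : 'cV[K]_m) : hecke_alg := presgen hecke_rel (inl v).
Definition hT (g : gT) : hecke_alg := presgen hecke_rel (inr g).
Definition hW (x : grpalg K gT) : hecke_alg := \sum_g x g *: hT g.

Lemma hV_linear c v w : hV (c *: v + w) = c *: hV v + hV w.
Proof.
by rewrite [LHS](presalg_relP (RelVlin c v w)) [LHS]pi_presalgD pi_presalgZ.
Qed.

Lemma hT1 : hT 1%g = 1.
Proof. exact: (presalg_relP RelT1). Qed.

Lemma hTM g h : hT (g * h)%g = hT g * hT h.
Proof. by rewrite [LHS](presalg_relP (RelTM g h)) [LHS]pi_presalgM. Qed.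

Lemma hTV g v : hT g * hV v = hV (rho g *m v) * hT g.
Proof.
by rewrite -[LHS]pi_presalgM (presalg_relP (RelTV g v)) [LHS]pi_presalgM.
Qed.

Lemma hVV v w : comm_br (hV v) (hV w) = hW (kappa v w).
Proof.
have piN x : \pi_hecke_alg (- x) = - \pi_hecke_alg x.
  by rewrite -scaleN1r [LHS]pi_presalgZ scaleN1r.
have := presalg_relP (RelVV v w); rewrite /comm_br [LHS]pi_presalgD piN.
rewrite [X in X + _]pi_presalgM [X in _ - X]pi_presalgM => ->.
rewrite [LHS](big_morph _ (@pi_presalgD _ _ hecke_rel) (@pi_presalg0 _ _ hecke_rel)).
by apply: eq_bigr => g _; exact: pi_presalgZ.
Qed.

Definition pbw_monomial (u : m.-tuple 'cV[K]_m) (p : {ffun 'I_m -> nat} * gT) :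
    hecke_alg :=
  (\prod_(i < m) hV (tnth u i) ^+ p.1 i) * hT p.2.

Definition pbw : Prop :=
  forall u : m.-tuple 'cV[K]_m, basis_of fullv u -> formal_basis (pbw_monomial u).

Definition skew_forms : Prop :=
  forall g, (forall c u v w,
               kappa (c *: u + v) w g = c * kappa u w g + kappa v w g)
         /\ (forall v w, kappa v w g = - kappa w v g).

Definition graded_hecke : Prop := skew_forms /\ pbw.

End HeckeAlgebra.

Definition form (K : pzRingType) m (B : 'M[K]_m) (u v : 'cV[K]_m) : K :=
  (u^T *m B *m v) 0 0.

Section ReflectionGroup.
Variables (R : realType) (gT : finGroupType) (m : nat).
Variable rho : mx_representation R [set: gT] m.

Definition reflection_mx (M : 'M[R]_m) : bool := \rank (M - 1%:M) == 1%N.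

Definition reflection_group : Prop :=
  mx_faithful rho /\ <<[set g | reflection_mx (rho g)]>>%g = [set: gT].

Definition invariant_inner_product (B : 'M[R]_m) : Prop :=
  [/\ B^T = B,
      forall v, v != 0 -> 0 < form B v v
    & forall g v w, form B (rho g *m v) (rho g *m w) = form B v w].

Variable B : 'M[R]_m.

Definition coroot (a : 'cV[R]_m) : 'cV[R]_m := (2 / form B a a) *: a.

Definition acts_as_refl (g : gT) (a : 'cV[R]_m) : Prop :=
  forall v, rho g *m v = v - form B v (coroot a) *: a.

Definition root_system (Phi : {fset 'cV[R]_m}) : Prop :=
  [/\ forall a, a \in Phi -> a != 0 /\ exists g, acts_as_refl g a,
      forall g a, a \in Phi -> rho g *m a \in Phi
    & forall g, reflection_mx (rho g) ->
        exists a, forall b, b \in Phi /\ acts_as_refl g b <-> b = a \/ b = - a].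

(* s_a as an element of W, unique as rho is faithful; 1 is a dummy value,
   not reached on roots *)
Definition refl_elt (a : 'cV[R]_m) : gT :=
  odflt 1%g [pick g | `[< acts_as_refl g a >]].

Definition positive n (Delta : n.-tuple 'cV[R]_m) (a : 'cV[R]_m) : bool :=
  (a \in <<Delta>>%VS) && [forall i, 0 <= coord Delta i a].

Definition simple_system n (Phi : {fset 'cV[R]_m}) (Delta : n.-tuple 'cV[R]_m) :
    Prop :=
  [/\ forall i, tnth Delta i \in Phi, free Delta
    & forall a, a \in Phi -> positive Delta a || positive Delta (- a)].

Definition cvec (v : 'cV[R]_m) : 'cV[R[i]]_m := map_mx (real_complex R) v.
Definition cform : 'cV[R[i]]_m -> 'cV[R[i]]_m -> R[i] :=
  form (map_mx (real_complex R) B).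
Definition crep : mx_representation R[i] [set: gT] m :=
  map_repr (real_complex R) rho.

Variables (Phi : {fset 'cV[R]_m}) (n : nat) (Delta : n.-tuple 'cV[R]_m).
Variable k : 'cV[R]_m -> R[i].

Definition h_pairing (v : 'cV[R[i]]_m) : grpalg R[i] gT :=
  2^-1 *: \sum_(a <- Phi | positive Delta a)
            (k a * cform v (cvec (coroot a))) *: gbase (refl_elt a).

Definition h_kappa (v w : 'cV[R[i]]_m) : grpalg R[i] gT :=
  - comm_br (h_pairing v) (h_pairing w).

Definition tilde (v : 'cV[R[i]]_m) : hecke_alg crep h_kappa :=
  hV crep h_kappa v - hW crep h_kappa (h_pairing v).

End ReflectionGroup.

(* Main.v *)
(* Write h v = <v, h>. For every x in W the vector h v x *: (w - x w) is
   symmetric in v and w. Hence the elements v - h v of A commute, and A acts on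
   what ought to be A itself as a free right module with basis t_g over the
   symmetric algebra of V: t_g permutes the basis and
   v t_y = t_y (y^-1 v) = t_y ((y^-1 v)~ + h (y^-1 v)). Written as matrices over a
   polynomial ring, these operators satisfy the relations of A, provided that
   [h v, h w] is W-equivariant; the leading term of a PBW monomial in this
   representation is the corresponding monomial of the polynomial ring, so PBW
   monomials are independent. They span by the usual straightening.
   Equivariance needs checking for simple reflections only, since these generate
   W; a simple reflection permutes the positive roots other than its own, so
   t_s (h v) = h (s v) t_s + k <v, alpha^vee>, which is also the last relation of
   the theorem. *)

Require Import Defs.
From HB Require Import structures.
From mathcomp Require Import all_boot all_order all_algebra all_fingroup.
From mathcomp Require Import mxrepresentation generic_quotient ring_quotient.
From mathcomp Require Import finmap monalg.
From mathcomp Require Import boolp reals complex.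
From mathcomp Require Import ring.

Set Implicit Arguments.
Unset Strict Implicit.
Unset Printing Implicit Defensive.

Import Order.TTheory GRing.Theory Num.Theory.
Local Open Scope ring_scope.

(** * Algebras given by generators and relations *)

Section Presentation.
Variables (K : fieldType) (X : choiceType).
Local Notation F := {malg K[{fmonom X}]}.

Variable rel : F -> Prop.

(** Elements of the free algebra are finite combinations of words, and a word maps to the product of
    the classes of its letters. *)
Lemma presalg_ind (P : presalg rel -> Prop) :
  P 0 -> (forall c s y, P y -> P (c *: \prod_(x <- s) presgen rel x + y)) ->
  forall y, P y.
Proof.
move=> P0 PD; elim/quotP=> /= y _.
rewrite [y]monalgE; elim: (msupp y : seq _) => [|w r IHr] /=.
  by rewrite big_nil [X in P X]pi_presalg0.
rewrite big_cons [X in P X]pi_presalgD.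
suff -> : \pi_(presalg rel)%qT << y@_w *g w >> =
    y@_w *: \prod_(x <- w) presgen rel x by exact: PD.
have -> : << y@_w *g w >> = y@_w *: << w >> :> F.
  by apply/malgP=> k; rewrite mcoeffZ !mcoeffU mulr_natr.
rewrite [LHS]pi_presalgZ; congr (_ *: _).
rewrite -[in LHS](fmK w); elim: (w : seq X) => [|x s IHs].
  by rewrite big_nil -[RHS]pi_presalg1 -fmoneE.
rewrite big_cons -IHs -[RHS]pi_presalgM; congr (\pi_(_)%qT _).
rewrite malgM_def fgmulUU mulr1; congr << _ >>.
by apply/eqP; rewrite fmP fmM fmU.
Qed.

Section Lift.
Variables (Q : nzRingType) (f : {rmorphism K -> Q}) (gen : X -> Q).
Hypothesis f_central : forall c q, GRing.comm (f c) q.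

Definition word_eval (w : {fmonom X}) : Q := \prod_(x <- w) gen x.

Lemma word_eval_mmorphism : mmorphism word_eval.
Proof.
split=> [w1 w2|]; last by rewrite /word_eval fm1 big_nil.
by rewrite /word_eval fmM big_cat.
Qed.

HB.instance Definition _ :=
  isMultiplicative.Build {fmonom X} Q word_eval word_eval_mmorphism.

Definition free_eval : F -> Q := mmap f word_eval.

Lemma free_evalD x y : free_eval (x + y) = free_eval x + free_eval y.
Proof. exact: mmapD. Qed.
Lemma free_evalB x y : free_eval (x - y) = free_eval x - free_eval y.
Proof. exact: mmapB. Qed.
Lemma free_eval0 : free_eval 0 = 0. Proof. exact: mmap0. Qed.
Lemma free_eval1 : free_eval 1 = 1. Proof. exact: mmap1. Qed.
Lemma free_evalZ c x : free_eval (c *: x) = f c * free_eval x.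
Proof. exact: mmapZ. Qed.
Lemma free_evalM x y : free_eval (x * y) = free_eval x * free_eval y.
Proof.
have [+ _] := @commr_mmap_is_multiplicative _ _ _ f word_eval
  (fun g m m' => f_central _ _).
exact.
Qed.
Lemma free_evalX x : free_eval << fmu x >> = gen x.
Proof.
by rewrite /free_eval mmapU /= (rmorph1 f) mul1r /word_eval fmU big_seq1.
Qed.

(* Stated for two products at once: rewriting them one by one makes the
   unifier compare the two products by unfolding them. *)
Lemma free_eval_mulB x y z t :
  free_eval (<< fmu x >> * << fmu y >> - << fmu z >> * << fmu t >>) =
  gen x * gen y - gen z * gen t.
Proof.
have evalM a b : free_eval (<< fmu a >> * << fmu b >>) = gen a * gen b.
  by rewrite free_evalM; congr (_ * _); exact: free_evalX.
by rewrite free_evalB; congr (_ - _); exact: evalM.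
Qed.

(** The universal property of the presentation: an evaluation that kills the relations kills the
    ideal they generate. Scalars enter through a central [f] because the target will be a ring of
    matrices over a polynomial ring. *)
Lemma presalg_lift : (forall x, rel x -> free_eval x = 0) ->
  exists Phi : presalg rel -> Q,
    [/\ forall x y, Phi (x + y) = Phi x + Phi y,
        forall x y, Phi (x * y) = Phi x * Phi y,
        forall c x, Phi (c *: x) = f c * Phi x,
        Phi 0 = 0 /\ Phi 1 = 1
      & forall x, Phi (presgen rel x) = gen x].
Proof.
move=> rel0.
have ideal0 x : ideal_gen rel x -> free_eval x = 0.
  elim=> {x} [x /rel0 //||x y _ x0 _ y0|a x _ x0|x a _ x0].
  - exact: free_eval0.
  - by rewrite free_evalB x0 y0 subrr.
  - by rewrite free_evalM x0 mulr0.
  - by rewrite free_evalM x0 mul0r.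
(* Evaluation at the chosen representative; by [PhiE] any other representative gives the same
   value. *)
pose Phi (x : presalg rel) := free_eval (repr x).
have PhiE x : Phi (\pi_(presalg rel)%qT x) = free_eval x.
  apply/eqP; rewrite -subr_eq0 -free_evalB; apply/eqP/ideal0.
  by apply/presalg_eqP; rewrite reprK.
exists Phi; split=> [x y|x y|c x||x].
- by rewrite -[x]reprK -[y]reprK -[X in Phi X]pi_presalgD !PhiE free_evalD.
- by rewrite -[x]reprK -[y]reprK -[X in Phi X]pi_presalgM !PhiE free_evalM.
- by rewrite -[x]reprK -[X in Phi X]pi_presalgZ !PhiE free_evalZ.
- rewrite -[X in Phi X = 0]pi_presalg0 -[X in Phi X = 1]pi_presalg1 !PhiE.
  by rewrite free_eval0 free_eval1.
- by rewrite PhiE free_evalX.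
Qed.

End Lift.
End Presentation.

(** * Degrees and monomials in a polynomial ring *)

Section Degree.
Variables (K : fieldType) (m : nat).
Local Notation S := {malg K['X_{1..m}]}.
Implicit Types (p q : S).

(** A strict bound stated on coefficients, so that the zero polynomial satisfies it even for
    [d = 0]. *)
Definition deg_lt d p := forall k, (d <= mdeg k)%N -> p@_k = 0.

Lemma deg_lt0 d : deg_lt d 0.
Proof. by move=> k _; rewrite mcoeff0. Qed.

Lemma deg_ltD d p q : deg_lt d p -> deg_lt d q -> deg_lt d (p + q).
Proof. by move=> pd qd k dk; rewrite mcoeffD pd // qd // addr0. Qed.

Lemma deg_lt_sum d (I : Type) (r : seq I) (P : pred I) (F : I -> S) :
  (forall i, P i -> deg_lt d (F i)) -> deg_lt d (\sum_(i <- r | P i) F i).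
Proof.
by move=> Fd; elim/big_rec: _ => [|i p Pi]; [exact: deg_lt0|apply/deg_ltD/Fd].
Qed.

Lemma deg_ltW d e p : (d <= e)%N -> deg_lt d p -> deg_lt e p.
Proof. by move=> de pd k ek; rewrite pd // (leq_trans de). Qed.

(** The bound [d.+1] says that [p] has degree at most [d]; this asymmetry keeps the estimate
    sharp. *)
Lemma deg_ltM d e p q : deg_lt d.+1 p -> deg_lt e q -> deg_lt (d + e) (p * q).
Proof.
move=> pd qe k dek; apply/eqP; rewrite mcoeff_eq0; apply/negP.
case/msuppM_le=> [k1 [k2 [k1p k2q kE]]]; move: dek; rewrite kE mdegM leqNgt.
suff -> : (mdeg k1 + mdeg k2 < d + e)%N by [].
rewrite -addnS leq_add // ?[(mdeg k1 <= _)%N]leqNgt 1?[(mdeg k2 < _)%N]ltnNge.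
  by apply/negP=> dk1; move: k1p; rewrite -mcoeff_neq0 pd ?eqxx.
by apply/negP=> ek2; move: k2q; rewrite -mcoeff_neq0 qe ?eqxx.
Qed.

Lemma deg_ltC c : deg_lt 1 (c%:MP : S).
Proof.
by move=> k k_gt0; rewrite mcoeffU; case: eqP k_gt0 => // <-; rewrite mdeg1.
Qed.

Lemma deg_ltX i : deg_lt 2 (<< ucm i >> : S).
Proof.
by move=> k k_gt1; rewrite mcoeffU; case: eqP k_gt1 => // <-; rewrite mdegU.
Qed.

Lemma deg_ltZ c d p : deg_lt d p -> deg_lt d (c *: p).
Proof. by move=> pd k dk; rewrite mcoeffZ pd // mulr0. Qed.

Definition word_monom (s : seq 'I_m) : 'X_{1..m} :=
  \big[@mmul 'X_{1..m}/@mone 'X_{1..m}]_(i <- s) ucm i.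

Lemma word_monomE s i : word_monom s i = count_mem i s.
Proof.
rewrite /word_monom; elim: s => [|j s IHs]; first by rewrite big_nil cm1.
by rewrite big_cons cmM IHs cmU.
Qed.

Lemma mdeg_word_monom s : mdeg (word_monom s) = size s.
Proof.
rewrite mdeg_prod (eq_bigr (fun=> 1%N)) => [|i _]; last exact: mdegU.
by rewrite sum1_size.
Qed.

Lemma prod_varE s : \prod_(i <- s) (<< ucm i >> : S) = << word_monom s >>.
Proof.
rewrite /word_monom; elim: s => [|j s IHs]; first by rewrite !big_nil.
rewrite [LHS]big_cons IHs [in RHS]big_cons -[in RHS](mulr1 (1 : K)).
exact: fgmulUU.
Qed.

(** Turns the ordered product of a PBW monomial into a product over a list, the form in which words
    are reordered and evaluated. *)
Definition exponent_word (a : 'I_m -> nat) : seq 'I_m :=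
  flatten [seq nseq (a i) i | i <- index_enum 'I_m].

Lemma count_exponent_word a i : count_mem i (exponent_word a) = a i.
Proof.
rewrite count_flatten -map_comp sumnE big_map /= (bigD1 i) //=.
rewrite count_nseq /= eqxx mul1n big1 ?addn0 // => j /negPf ji.
by rewrite count_nseq /= ji.
Qed.

Lemma prod_exponent_word (A : pzRingType) (F : 'I_m -> A) a :
  \prod_(i < m) F i ^+ a i = \prod_(i <- exponent_word a) F i.
Proof.
rewrite /exponent_word big_flatten big_map.
by apply: eq_bigr => i _; rewrite big_nseq -Monoid.iteropE.
Qed.

End Degree.

(** * Matrices indexed by the group *)

Section KernelMatrix.
Variables (S : comNzRingType) (gT : finGroupType).
Local Notation N := #|gT|.-1.
Implicit Types (f g : gT -> gT -> S).

Let card_gT : #|gT| = N.+1.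
Proof. by rewrite prednK //; apply/card_gt0P; exists 1%g. Qed.

Let idx (x : gT) : 'I_N.+1 := cast_ord card_gT (enum_rank x).
Let elt (i : 'I_N.+1) : gT := enum_val (cast_ord (esym card_gT) i).
Let idxK : cancel idx elt.
Proof. by move=> x; rewrite /elt cast_ordK enum_rankK. Qed.
Let eltK : cancel elt idx.
Proof. by move=> i; rewrite /idx enum_valK cast_ordKV. Qed.

(** The size is the order of the group, written as a successor so that the matrices form a ring;
    identities between matrices can then be checked on functions of two group elements. *)
Definition kernel_mx f : 'M[S]_N.+1 := \matrix_(i, j) f (elt i) (elt j).

Definition kernel_entry (M : 'M[S]_N.+1) x y := M (idx x) (idx y).

Lemma kernel_entryE f x y : kernel_entry (kernel_mx f) x y = f x y.
Proof. by rewrite /kernel_entry mxE !idxK. Qed.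

Lemma kernel_entryD M1 M2 x y :
  kernel_entry (M1 + M2) x y = kernel_entry M1 x y + kernel_entry M2 x y.
Proof. by rewrite /kernel_entry mxE. Qed.

Lemma kernel_entry0 x y : kernel_entry 0 x y = 0.
Proof. by rewrite /kernel_entry mxE. Qed.

Lemma kernel_entryZ a M x y : kernel_entry (a%:M * M) x y = a * kernel_entry M x y.
Proof. by rewrite /kernel_entry [a%:M * M]mul_scalar_mx mxE. Qed.

Lemma eq_kernel_mx f g : f =2 g -> kernel_mx f = kernel_mx g.
Proof. by move=> fg; apply/matrixP=> i j; rewrite !mxE fg. Qed.

Lemma kernel_mxD f g :
  kernel_mx f + kernel_mx g = kernel_mx (fun x y => f x y + g x y).
Proof. by apply/matrixP=> i j; rewrite !mxE. Qed.

Lemma kernel_mxB f g :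
  kernel_mx f - kernel_mx g = kernel_mx (fun x y => f x y - g x y).
Proof. by apply/matrixP=> i j; rewrite !mxE. Qed.

Lemma kernel_mx0 : kernel_mx (fun _ _ => 0) = 0.
Proof. by apply/matrixP=> i j; rewrite !mxE. Qed.

Lemma kernel_mx1 : kernel_mx (fun x y => (x == y)%:R) = 1.
Proof. by apply/matrixP=> i j; rewrite !mxE (inj_eq (can_inj eltK)). Qed.

Lemma kernel_mxM f g :
  kernel_mx f * kernel_mx g = kernel_mx (fun x y => \sum_z f x z * g z y).
Proof.
apply/matrixP=> i j; rewrite !mxE [RHS](reindex elt) /=.
  by apply: eq_bigr => k _; rewrite !mxE.
by exists idx => x _; [exact: eltK|exact: idxK].
Qed.

Lemma kernel_mxZ a f : a%:M * kernel_mx f = kernel_mx (fun x y => a * f x y).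
Proof. by rewrite [LHS]mul_scalar_mx; apply/matrixP=> i j; rewrite !mxE. Qed.

Lemma kernel_mx_sum (I : Type) (r : seq I) (P : pred I) (F : I -> gT -> gT -> S) :
  \sum_(i <- r | P i) kernel_mx (F i) =
  kernel_mx (fun x y => \sum_(i <- r | P i) F i x y).
Proof.
apply/matrixP=> i j; rewrite summxE mxE.
by apply: eq_bigr => k _; rewrite mxE.
Qed.

End KernelMatrix.

(** * A matrix representation of the algebra *)

Section GroupAlgebraTheory.
Variables (K : fieldType) (gT : finGroupType).
Implicit Types (x y : grpalg K gT).

Lemma gmulE x y g : (x * y) g = \sum_z x z * y (z^-1 * g)%g.
Proof. by rewrite ffunE. Qed.

Lemma gbase_mulE g x z : (gbase g * x) z = x (g^-1 * z)%g.
Proof.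
rewrite gmulE (bigD1 g) //= !ffunE eqxx mul1r big1 ?addr0 // => i /negPf ig.
by rewrite ffunE ig mul0r.
Qed.

Lemma mul_gbaseE g x z : (x * gbase g) z = x (z * g^-1)%g.
Proof.
rewrite gmulE (bigD1 (z * g^-1)%g) //= ffunE invMg invgK mulgKV eqxx mulr1.
rewrite big1 ?addr0 // => i /negPf ig; rewrite ffunE -(inj_eq (mulgI i)) mulKVg.
by rewrite -(inj_eq (mulIg g^-1%g)) mulgK eq_sym ig mulr0.
Qed.

Lemma gbase_sum x : x = \sum_g x g *: gbase g.
Proof.
apply/ffunP=> z; rewrite sum_ffunE (bigD1 z) //= !ffunE eqxx.
rewrite [_ *: _]mulr1 big1 ?addr0 // => i /negPf iz.
by rewrite !ffunE eq_sym iz [LHS]mulr0.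
Qed.

End GroupAlgebraTheory.

Section RepresentationAction.
Variables (K : comUnitRingType) (gT : finGroupType) (m : nat).
Variable rho : mx_representation K [set: gT] m.

Lemma repr_actM g x (v : 'cV[K]_m) : rho (g * x)%g *m v = rho g *m (rho x *m v).
Proof. by rewrite mulmxA -repr_mxM ?in_setT. Qed.

Lemma repr_actK g (v : 'cV[K]_m) : rho g^-1%g *m (rho g *m v) = v.
Proof. by rewrite -repr_actM mulVg repr_mx1 mul1mx. Qed.

Lemma repr_actVK g (v : 'cV[K]_m) : rho g *m (rho g^-1%g *m v) = v.
Proof. by rewrite -repr_actM mulgV repr_mx1 mul1mx. Qed.

End RepresentationAction.

Section KernelRepresentation.
Variables (K : fieldType) (gT : finGroupType) (m : nat).
Variable rho : mx_representation K [set: gT] m.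
Variable h : 'cV[K]_m -> grpalg K gT.
Variable kappa : 'cV[K]_m -> 'cV[K]_m -> grpalg K gT.
Hypothesis h_linear : forall c (v w : 'cV[K]_m), h (c *: v + w) = c *: h v + h w.
Hypothesis h_sym : forall x (v w : 'cV[K]_m),
  h v x *: (w - rho x *m w) = h w x *: (v - rho x *m v).
Hypothesis kappaE : forall v w, kappa v w = - comm_br (h v) (h w).
Hypothesis kappaJ : forall g v w x,
  kappa (rho g *m v) (rho g *m w) x = kappa v w (x ^ g)%g.

Variables (S : comNzRingType) (iota : {rmorphism K -> S}) (L : 'cV[K]_m -> S).
Hypothesis L_linear : forall c (v w : 'cV[K]_m),
  L (c *: v + w) = iota c * L v + L w.

(** [h_sym] moved by [rho x^-1], since the kernels below act on vectors by inverses. *)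
Let h_symV x (v w : 'cV[K]_m) :
  h v x *: (w - rho x^-1%g *m w) = h w x *: (v - rho x^-1%g *m v).
Proof.
have := congr1 (mulmx (rho x^-1%g)) (h_sym x v w).
rewrite -!scalemxAr !mulmxBr !repr_actK -[_ - w]opprB -[_ - v]opprB !scalerN.
exact: oppr_inj.
Qed.

(* The operators below give the left action of the algebra on itself, seen as
   a free right module with basis t_g over the symmetric algebra generated by
   the commuting elements v - h v: v t_y = t_y (y^-1 v) and
   y^-1 v = (y^-1 v - h (y^-1 v)) + h (y^-1 v). *)
Definition vec_kernel (v : 'cV[K]_m) (x y : gT) : S :=
  (x == y)%:R * L (rho y^-1%g *m v) + iota (h (rho y^-1%g *m v) (y^-1 * x)%g).

Definition grp_kernel (g x y : gT) : S := (x == g * y)%g%:R.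

(** Each product is split by degree in [L], as in [step]. The quadratic terms agree because [S] is
    commutative, the linear terms cancel by [L] applied to [h_symV], and the constant terms leave a
    commutator of values of [h]. *)
Lemma vec_kernel_comm v w x y :
  \sum_z vec_kernel v x z * vec_kernel w z y
  - \sum_z vec_kernel w x z * vec_kernel v z y = iota (kappa v w (x * y^-1)%g).
Proof.
set v' := rho y^-1%g *m v; set w' := rho y^-1%g *m w; set q := (y^-1 * x)%g.
have step a b : \sum_z vec_kernel a x z * vec_kernel b z y =
    (x == y)%:R * L (rho y^-1%g *m a) * L (rho y^-1%g *m b)
    + iota (h (rho y^-1%g *m a) q) * L (rho y^-1%g *m b)
    + iota (h (rho y^-1%g *m b) q) * L (rho q^-1%g *m (rho y^-1%g *m a))
    + iota (\sum_z h (rho y^-1%g *m b) z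
        * h (rho z^-1%g *m (rho y^-1%g *m a)) (z^-1 * q)%g).
  under eq_bigr => z _ do rewrite [vec_kernel b _ _]/vec_kernel mulrDr.
  rewrite big_split /= (bigD1 y) //= eqxx mul1r big1 ?addr0; last first.
    by move=> z /negPf zy; rewrite zy mul0r mulr0.
  rewrite {1}/vec_kernel mulrDl -!addrA; congr (_ + (_ + _)).
  under eq_bigr => z _ do rewrite /vec_kernel mulrDl.
  rewrite big_split /= (bigD1 x) //= eqxx mul1r big1 ?addr0; last first.
    by move=> z /negPf zx; rewrite eq_sym zx !mul0r.
  congr (_ + _).
    by rewrite mulrC invMg repr_actM repr_actK.
  rewrite raddf_sum (reindex_inj (mulgI y)) /=; apply: eq_bigr => z _.
  by rewrite -rmorphM mulrC mulKg invMg -mulgA repr_actM.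
rewrite !step -/v' -/w' (mulrAC _ (L w') (L v')).
(* Equivariance of [kappa] is needed here, to pass from the vectors moved by [y^-1] back to [v] and
   [w]. *)
have kE : kappa v w (x * y^-1)%g = kappa v' w' q.
  by rewrite kappaJ conjgE invgK /q -!mulgA mulKVg.
rewrite kE kappaE /comm_br opprB.
(* In each summand, [h] applied to [h_symV z v' w'] and evaluated at [z^-1 * q] trades the values of
   [h] at the vectors moved by [z^-1] for those at [v'] and [w']. *)
have -> : (h w' * h v' - h v' * h w') q = 
  \sum_z h w' z * h (rho z^-1%g *m v') (z^-1 * q)%g
  - \sum_z h v' z * h (rho z^-1%g *m w') (z^-1 * q)%g.
  rewrite ffunE [X in X + _]gmulE ffunE gmulE -!sumrB; apply: eq_bigr => z _.
  have hD a b : h (a - b) = h a - h b.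
    by rewrite addrC -scaleN1r h_linear scaleN1r addrC.
  have hZ c a : h (c *: a) = c *: h a.
    by rewrite -[c *: a]addr0 h_linear -[in h 0](subrr 0) hD subrr addr0.
  have := congr1 (fun t => h t (z^-1 * q)%g) (h_symV z v' w').
  rewrite !hZ !hD !ffunE /= ![_ *: _]mulrBr => /eqP.
  rewrite -subr_eq0 => /eqP E; apply/eqP; rewrite -subr_eq0 -oppr_eq0 -E.
  by apply/eqP; ring.
rewrite raddfB /=.
have LB a b : L (a - b) = L a - L b.
  by rewrite addrC -scaleN1r L_linear rmorphN1 mulN1r addrC.
have LZ c a : L (c *: a) = iota c * L a.
  by rewrite -[c *: a]addr0 L_linear -[in L 0](subrr 0) LB subrr addr0.
have := congr1 L (h_symV q v' w'); rewrite !LZ !LB !mulrBr.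
move/eqP; rewrite -subr_eq0 => /eqP E; apply/eqP; rewrite -subr_eq0 -E.
by apply/eqP; ring.
Qed.

Lemma vec_kernel_linear c (v w : 'cV[K]_m) x y :
  vec_kernel (c *: v + w) x y = iota c * vec_kernel v x y + vec_kernel w x y.
Proof.
have hE a b z : h (c *: a + b) z = c * h a z + h b z by rewrite h_linear !ffunE.
by rewrite /vec_kernel mulmxDr -scalemxAr L_linear hE rmorphD rmorphM /=; ring.
Qed.

Lemma grp_kernelM g g' x y :
  grp_kernel (g * g') x y = \sum_z grp_kernel g x z * grp_kernel g' z y.
Proof.
rewrite (bigD1 (g' * y)%g) //= big1 ?addr0 => [|z /negPf zy].
  by rewrite /grp_kernel eqxx mulr1 mulgA.
by rewrite {2}/grp_kernel zy mulr0.
Qed.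

Lemma grp_kernel_mull g (k : gT -> gT -> S) x y :
  \sum_z grp_kernel g x z * k z y = k (g^-1 * x)%g y.
Proof.
rewrite (bigD1 (g^-1 * x)%g) //= big1 ?addr0 => [|z zx].
  by rewrite /grp_kernel mulKVg eqxx mul1r.
rewrite /grp_kernel -(inj_eq (mulgI g^-1%g)) mulKg eq_sym (negPf zx).
by rewrite mul0r.
Qed.

Lemma grp_kernel_mulr g (k : gT -> gT -> S) x y :
  \sum_z k x z * grp_kernel g z y = k x (g * y)%g.
Proof.
rewrite (bigD1 (g * y)%g) //= big1 ?addr0 => [|z /negPf zx].
  by rewrite /grp_kernel eqxx mulr1.
by rewrite /grp_kernel zx mulr0.
Qed.

(** The relations are checked on kernels. Passing t_g across v works because
    [vec_kernel v (g^-1 * x) y] equals [vec_kernel (rho g *m v) x (g * y)]; the bracket of two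
    vectors is [vec_kernel_comm]. *)
Lemma hecke_kernel_rep : exists Phi : hecke_alg rho kappa -> 'M[S]_#|gT|.-1.+1,
  [/\ forall x y, Phi (x + y) = Phi x + Phi y,
      forall x y, Phi (x * y) = Phi x * Phi y,
      forall c x, Phi (c *: x) = (iota c)%:M * Phi x,
      Phi 0 = 0 /\ Phi 1 = 1
    & (forall v, Phi (hV rho kappa v) = kernel_mx (vec_kernel v))
      /\ forall g, Phi (hT rho kappa g) = kernel_mx (grp_kernel g)].
Proof.
pose gen (x : 'cV[K]_m + gT) : 'M[S]_#|gT|.-1.+1 :=
  match x with inl v => kernel_mx (vec_kernel v)
             | inr g => kernel_mx (grp_kernel g) end.
pose f : {rmorphism K -> 'M[S]_#|gT|.-1.+1} := scalar_mx \o iota.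
have fE c : f c = (iota c)%:M by [].
have f_central c q : GRing.comm (f c) q by exact/esym/scalar_mxC.
case: (@presalg_lift _ _ (hecke_rel rho kappa) _ f gen f_central); last first.
  move=> Phi [PhiD PhiM PhiZ Phi01 PhiX]; exists Phi; split=> //.
  by split=> ?; exact: PhiX.
move=> _ [c v w||g h'|g v|v w].
- rewrite free_evalB free_evalD free_evalZ fE !free_evalX /=.
  rewrite kernel_mxZ kernel_mxD kernel_mxB -[RHS](kernel_mx0 S gT).
  by apply: eq_kernel_mx => x y; rewrite vec_kernel_linear subrr.
- rewrite free_evalB free_eval1 free_evalX /= -(kernel_mx1 S gT) kernel_mxB.
  rewrite -[RHS](kernel_mx0 S gT); apply: eq_kernel_mx => x y.
  by rewrite /grp_kernel mul1g subrr.
- rewrite free_evalB (free_evalM gen f_central) !free_evalX /=.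
  rewrite kernel_mxM kernel_mxB.
  rewrite -[RHS](kernel_mx0 S gT); apply: eq_kernel_mx => x y.
  by rewrite grp_kernelM subrr.
- rewrite (free_eval_mulB gen f_central) /= !kernel_mxM kernel_mxB.
  rewrite -[RHS](kernel_mx0 S gT); apply: eq_kernel_mx => x y.
  rewrite grp_kernel_mull grp_kernel_mulr /vec_kernel !invMg.
  rewrite repr_actM repr_actK mulgA.
  by rewrite -(inj_eq (mulgI g)) mulKVg subrr.
- rewrite free_evalB (free_eval_mulB gen f_central) /=.
  rewrite !kernel_mxM kernel_mxB.
  rewrite (big_morph _ (free_evalD f gen) (free_eval0 f gen)).
  under eq_bigr => g _ do rewrite free_evalZ fE free_evalX /= kernel_mxZ.
  rewrite kernel_mx_sum kernel_mxB -[RHS](kernel_mx0 S gT).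
  apply: eq_kernel_mx => x y; rewrite vec_kernel_comm.
  (* Only the group element x y^-1 has a nonzero entry at row [x] and column [y]. *)
  rewrite (bigD1 (x * y^-1)%g) //= /grp_kernel mulgKV eqxx mulr1.
  rewrite big1 ?addr0 ?subrr //.
  move=> g gxy; rewrite -(inj_eq (mulIg y^-1%g)) mulgK eq_sym (negPf gxy).
  by rewrite mulr0.
Qed.

(** * Leading terms of words in the representation *)

Lemma vec_kernel_mull v (k : gT -> gT -> S) x y :
  \sum_z vec_kernel v x z * k z y =
  L (rho x^-1%g *m v) * k x y
  + \sum_z iota (h (rho z^-1%g *m v) (z^-1 * x)%g) * k z y.
Proof.
under eq_bigr => z _ do rewrite /vec_kernel mulrDl.
rewrite big_split /= (bigD1 x) //= eqxx mul1r big1 ?addr0 // => z /negPf zx.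
by rewrite eq_sym zx !mul0r.
Qed.

(** An abstract strict degree bound: [lt d p] reads as degree of [p] less than [d]. Constants have
    degree at most 0 and the values of [L] degree at most 1. *)
Variable lt : nat -> S -> Prop.
Hypothesis lt0 : forall d, lt d 0.
Hypothesis ltD : forall d p q, lt d p -> lt d q -> lt d (p + q).
Hypothesis ltW : forall d e p, (d <= e)%N -> lt d p -> lt e p.
Hypothesis ltM : forall d e p q, lt d.+1 p -> lt e q -> lt (d + e) (p * q).
Hypothesis ltC : forall c, lt 1 (iota c).
Hypothesis L_lt : forall v, lt 2 (L v).

Let lt_sum d (I : finType) (F : I -> S) :
  (forall i, lt d (F i)) -> lt d (\sum_i F i).
Proof. by move=> Fd; elim/big_rec: _ => [|i p _]; [exact: lt0|exact: ltD]. Qed.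

Let L_prod_lt (s : seq 'cV[K]_m) : lt (size s).+1 (\prod_(v <- s) L v).
Proof.
elim: s => [|v s IHs]; first by rewrite big_nil -(rmorph1 iota).
rewrite big_cons -[(size (v :: s)).+1]/(1 + (size s).+1)%N.
exact: ltM (L_lt v) IHs.
Qed.

(* The error term collects the summands in which some factor contributes its
   constant part h instead of its linear part. *)
Lemma prod_vec_kernel (s : seq 'cV[K]_m) :
  exists2 k : gT -> gT -> S,
    \prod_(v <- s) kernel_mx (vec_kernel v) = kernel_mx k
  & forall x y, exists2 r, lt (size s) r &
      k x y = (x == y)%:R * \prod_(v <- s) L (rho y^-1%g *m v) + r.
Proof.
elim: s => [|v s [k kE IHs]].
  exists (fun x y => (x == y)%:R); first by rewrite big_nil kernel_mx1.
  by move=> x y; exists 0; [exact: lt0|rewrite big_nil mulr1 addr0].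
exists (fun x y => \sum_z vec_kernel v x z * k z y).
  by rewrite big_cons kE kernel_mxM.
have k_lt x y : lt (size s).+1 (k x y).
  have [r r_lt ->] := IHs x y; apply: ltD; last exact: ltW r_lt.
  case: (x == y); last by rewrite mul0r; exact: lt0.
  rewrite mul1r -(size_map (mulmx (rho y^-1%g))) -(big_map _ xpredT L).
  exact: L_prod_lt.
move=> x y; have [r r_lt kxyE] := IHs x y.
exists (L (rho x^-1%g *m v) * r
        + \sum_z iota (h (rho z^-1%g *m v) (z^-1 * x)%g) * k z y).
  apply: ltD; first exact: (@ltM 1 _ _ _ (L_lt _) r_lt).
  by apply: lt_sum => z; exact: (@ltM 0 _ _ _ (ltC _) (k_lt z y)).
rewrite vec_kernel_mull addrA; congr (_ + _); rewrite kxyE mulrDr; congr (_ + _).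
rewrite [in RHS]big_cons mulrCA.
by have [->|_] := eqVneq x y; rewrite ?mul0r.
Qed.

(** The functional is the matrix entry in row 1 and column g^-1. Since t_x sends the basis vector
    t_(g^-1) to t_(x g^-1), and the leading part of a product of vectors is diagonal, a leading term
    survives only for x = g; at row 1 the twist by the group action is trivial. *)
Lemma leading_symbol g : exists ev : hecke_alg rho kappa -> S,
  [/\ forall a b, ev (a + b) = ev a + ev b, ev 0 = 0,
      forall c a, ev (c *: a) = iota c * ev a
    & forall (s : seq 'cV[K]_m) x, exists2 r, lt (size s) r &
        ev (\prod_(v <- s) hV rho kappa v * hT rho kappa x) =
        (x == g)%:R * \prod_(v <- s) L v + r].
Proof.
have [Phi [PhiD PhiM PhiZ [Phi0 Phi1] [PhiV PhiT]]] := hecke_kernel_rep.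
exists (fun a => kernel_entry (Phi a) 1%g g^-1%g); split=> [a b||c a|s x].
- by rewrite PhiD kernel_entryD.
- by rewrite Phi0 kernel_entry0.
- by rewrite PhiZ kernel_entryZ.
have [k kE kP] := prod_vec_kernel s.
have [r r_lt kr] := kP 1%g (x * g^-1)%g; exists r => //.
rewrite PhiM PhiT (big_morph Phi PhiM Phi1) (eq_bigr _ (fun v _ => PhiV v)).
rewrite kE kernel_mxM kernel_entryE grp_kernel_mulr kr eq_sym -eq_mulgV1.
congr (_ + _); have [->|_] := eqVneq x g; last by rewrite !mul0r.
rewrite mulgV invg1 repr_mx1; congr (_ * _); apply: eq_bigr => v _.
by rewrite mul1mx.
Qed.

End KernelRepresentation.

(** * Linear independence of the PBW monomials *)

Section Independence.
Variables (K : fieldType) (gT : finGroupType) (m : nat).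
Variable rho : mx_representation K [set: gT] m.
Variable h : 'cV[K]_m -> grpalg K gT.
Variable kappa : 'cV[K]_m -> 'cV[K]_m -> grpalg K gT.
Hypothesis h_linear : forall c (v w : 'cV[K]_m), h (c *: v + w) = c *: h v + h w.
Hypothesis h_sym : forall x (v w : 'cV[K]_m),
  h v x *: (w - rho x *m w) = h w x *: (v - rho x *m v).
Hypothesis kappaE : forall v w, kappa v w = - comm_br (h v) (h w).
Hypothesis kappaJ : forall g v w x,
  kappa (rho g *m v) (rho g *m w) x = kappa v w (x ^ g)%g.

Variable u : m.-tuple 'cV[K]_m.
Local Notation S := {malg K['X_{1..m}]}.

Definition linear_poly (v : 'cV[K]_m) : S :=
  \sum_(i < m) coord u i v *: << ucm i >>.
Local Notation L := linear_poly.
Local Notation iota := (@mkmalgU 'X_{1..m} K mone).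

Lemma linear_polyP c (v w : 'cV[K]_m) : L (c *: v + w) = iota c * L v + L w.
Proof.
rewrite mul_malgC scaler_sumr -big_split; apply: eq_bigr => i _.
by rewrite linearP scalerDl scalerA.
Qed.

Lemma linear_poly_lt v : deg_lt 2 (L v).
Proof. by apply: deg_lt_sum => i _; apply/deg_ltZ/deg_ltX. Qed.

Lemma linear_poly_basis i : free u -> L (tnth u i) = << ucm i >>.
Proof.
move=> uf; rewrite /linear_poly (bigD1 i) // (tnth_nth 0) coord_free //.
rewrite eqxx scale1r big1 => [|j ji]; first exact: addr0.
by rewrite coord_free // eq_sym (negPf ji) scale0r.
Qed.

(** Take (p, g) of greatest degree in the support of [c]. The functional of [leading_symbol] for
    [g], followed by the coefficient at the monomial of [p], isolates the coefficient of (p, g):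
    error terms have degree too small, and the other leading terms belong to another monomial or
    another group element. *)
Lemma pbw_coef0 (c : {malg K[({ffun 'I_m -> nat} * gT)%type]}) : basis_of fullv u ->
  \sum_(i <- msupp c) c@_i *: pbw_monomial rho kappa u i = 0 -> c = 0.
Proof.
move=> /basis_free uf c0; apply/malgP=> i1; rewrite mcoeff0; apply/eqP.
rewrite mcoeff_eq0; apply/negP=> i1c.
pose wt (i : {ffun 'I_m -> nat} * gT) := size (exponent_word i.1).
have [[p g] pgc pg_max] : exists2 i0, i0 \in msupp c &
    forall i, i \in msupp c -> (wt i <= wt i0)%N.
  pose i0 := [arg max_(i > [` i1c]%fset) wt (val i)].
  exists (val i0); first exact: valP.
  move=> i ic; rewrite /i0; case: arg_maxnP => // j _ /(_ [` ic]%fset); exact.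
have [ev [evD ev0 evZ evP]] := leading_symbol h_linear h_sym kappaE kappaJ
  linear_polyP (@deg_lt0 K m) (@deg_ltD K m) (@deg_ltW K m) (@deg_ltM K m)
  (@deg_ltC K m) linear_poly_lt g.
have := congr1 (mcoeff (word_monom (exponent_word p))) (congr1 ev c0).
rewrite (big_morph ev evD ev0) (big_morph _ (mcoeffD _) (mcoeff0 _)).
rewrite (big_fsetD1 (p, g)) //.
have term i : i \in msupp c ->
    (ev (c@_i *: pbw_monomial rho kappa u i))@_(word_monom (exponent_word p))
    = c@_i *+ (i == (p, g)).
  move=> ic; rewrite evZ mul_malgC mcoeffZ /pbw_monomial prod_exponent_word.
  rewrite -(big_map (tnth u) xpredT (hV rho kappa)).
  have [r r_lt ->] := evP (map (tnth u) (exponent_word i.1)) i.2.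
  rewrite mcoeffD (r_lt (word_monom _)) ?addr0; last first.
    by rewrite mdeg_word_monom size_map pg_max.
  rewrite big_map (eq_bigr _ (fun j _ => linear_poly_basis j uf)) prod_varE.
  rewrite mulr_natl mcoeffMn mcoeffU1 -mulrnA mulr_natr; congr (_ *+ _).
  case: i {ic r_lt} => q x; rewrite xpair_eqE mulnb; congr (nat_of_bool (_ && _)).
  apply/eqP/eqP => [qp|-> //]; apply/ffunP=> j.
  by rewrite -[LHS]count_exponent_word -[RHS]count_exponent_word -!word_monomE qp.
rewrite term // eqxx mulr1n big1_seq ?addr0 => [|i]; last first.
  by rewrite in_fsetD1 => /and3P[_ i_neq ic]; rewrite term // (negPf i_neq).
by rewrite ev0 mcoeff0 => /(etrans (esym (addr0 _)))/eqP; rewrite mcoeff_eq0 pgc.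
Qed.
End Independence.

(** * Spanning by PBW monomials *)

Section FormalSpan.
Variables (K : fieldType) (A : lmodType K) (I : choiceType) (f : I -> A).

Definition formal_sum (c : {malg K[I]}) : A := \sum_(i <- msupp c) c@_i *: f i.

(** Zero coefficients do no harm, so combinations with different supports can be compared over a
    common index set. *)
Lemma formal_sumEw (d : {fset I}) c : (msupp c `<=` d)%fset ->
  formal_sum c = \sum_(i <- d) c@_i *: f i.
Proof.
move=> cd; rewrite [LHS](big_fset_incl _ cd) // => i _ /mcoeff_outdom ->.
by rewrite scale0r.
Qed.

Lemma formal_sumP a c1 c2 :
  formal_sum (a *: c1 + c2) = a *: formal_sum c1 + formal_sum c2.
Proof.
pose d := (msupp c1 `|` msupp c2)%fset.
rewrite (@formal_sumEw d c1) ?fsubsetUl // (@formal_sumEw d c2) ?fsubsetUr //.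
rewrite (@formal_sumEw d); last first.
  exact: fsubset_trans (msuppD_le _ _) (fsetSU _ (msuppZ_le _ _)).
rewrite scaler_sumr -big_split; apply: eq_bigr => i _.
by rewrite mcoeffD mcoeffZ scalerDl scalerA.
Qed.

Lemma formal_sum0 : formal_sum 0 = 0.
Proof. by rewrite /formal_sum msupp0 big_seq_fset0. Qed.

Definition formally_spanned (x : A) : Prop := exists c, x = formal_sum c.

Lemma formally_spanned0 : formally_spanned 0.
Proof. by exists 0; rewrite formal_sum0. Qed.

Lemma formally_spannedP a x y :
  formally_spanned x -> formally_spanned y -> formally_spanned (a *: x + y).
Proof. by move=> [c1 ->] [c2 ->]; exists (a *: c1 + c2); rewrite formal_sumP. Qed.

Lemma formally_spanned_sum (J : Type) (r : seq J) (a : J -> K) (F : J -> A) :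
  (forall j, formally_spanned (F j)) ->
  formally_spanned (\sum_(j <- r) a j *: F j).
Proof.
move=> FS; elim: r => [|j r IHr].
  by rewrite big_nil; exact: formally_spanned0.
by rewrite big_cons; exact: formally_spannedP.
Qed.

Lemma formally_spanned_gen i : formally_spanned (f i).
Proof.
exists << i >>; rewrite (@formal_sumEw [fset i]%fset) ?msuppU_le //.
by rewrite big_seq_fset1 mcoeffUU scale1r.
Qed.

Lemma formal_basisP : (forall x, formally_spanned x) ->
  (forall c, formal_sum c = 0 -> c = 0) -> formal_basis f.
Proof.
move=> fS f0 x; have [c xE] := fS x; exists c; split=> // c' xE'.
apply/esym/eqP; rewrite -subr_eq0; apply/eqP/f0.
rewrite addrC -scaleN1r formal_sumP scaleN1r.
rewrite -[formal_sum c](xE) -[formal_sum c'](xE').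
exact: addNr.
Qed.

End FormalSpan.

(** * Straightening of words *)

Section Spanning.
Variables (K : fieldType) (gT : finGroupType) (m : nat).
Variable rho : mx_representation K [set: gT] m.
Variable kappa : 'cV[K]_m -> 'cV[K]_m -> grpalg K gT.
Local Notation A := (hecke_alg rho kappa).
Local Notation hV := (hV rho kappa).
Local Notation hT := (hT rho kappa).

Lemma hV0 : hV 0 = 0.
Proof.
have := hV_linear rho kappa 1 0 0; rewrite scaler0 addr0 scale1r.
by move/(congr1 (fun a => a - hV 0)); rewrite subrr addrK.
Qed.

(** A presented algebra may be zero and so carries no algebra structure; scalars are moved through
    products by [presalg_scaleAl] and its mirror image. *)
Lemma hscale_suml (J : Type) (r : seq J) (a : J -> K) (F : J -> A) (y : A) :
  (\sum_(j <- r) a j *: F j : A) * y = \sum_(j <- r) a j *: (F j * y).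
Proof.
elim: r => [|j r IHr]; first by rewrite !big_nil [LHS]mul0r.
by rewrite !big_cons [LHS]mulrDl IHr presalg_scaleAl.
Qed.

Lemma hscale_sumr (J : Type) (r : seq J) (a : J -> K) (F : J -> A) (y : A) :
  y * (\sum_(j <- r) a j *: F j : A) = \sum_(j <- r) a j *: (y * F j).
Proof.
elim: r => [|j r IHr]; first by rewrite !big_nil [LHS]mulr0.
by rewrite !big_cons [LHS]mulrDr IHr presalg_scaleAr.
Qed.

Lemma hV_sum (J : Type) (r : seq J) (a : J -> K) (v : J -> 'cV[K]_m) :
  hV (\sum_(j <- r) a j *: v j) = \sum_(j <- r) a j *: hV (v j).
Proof.
elim: r => [|j r IHr]; first by rewrite !big_nil hV0.
by rewrite !big_cons hV_linear IHr.
Qed.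

Definition hword (s : seq 'cV[K]_m) (g : gT) : A := \prod_(v <- s) hV v * hT g.

Lemma hT_prod x (s : seq 'cV[K]_m) :
  hT x * \prod_(v <- s) hV v = \prod_(v <- s) hV (rho x *m v) * hT x.
Proof.
elim: s => [|v s IHs]; first by rewrite !big_nil mul1r mulr1.
by rewrite !big_cons mulrA hTV -mulrA IHs mulrA.
Qed.

(** Group generators travel to the right, acting on the vectors they pass. *)
Lemma prod_presgenE (w : seq ('cV[K]_m + gT)) :
  exists s g, \prod_(x <- w) (presgen (hecke_rel rho kappa) x : A) = hword s g.
Proof.
elim: w => [|[v|x] w [s [g IHw]]].
- by exists [::], 1%g; rewrite /hword !big_nil hT1 mulr1.
- by exists (v :: s), g; rewrite big_cons IHw /hword big_cons -mulrA.
- exists (map (mulmx (rho x)) s), (x * g)%g.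
  rewrite big_cons IHw /hword -[presgen _ _]/(hT x) mulrA hT_prod big_map -mulrA.
  by rewrite -hTM.
Qed.

Lemma hword_sum (J : Type) (r : seq J) (a : J -> K) (v : J -> 'cV[K]_m) s1 s2 g :
  hword (s1 ++ \sum_(j <- r) a j *: v j :: s2) g =
  \sum_(j <- r) a j *: hword (s1 ++ v j :: s2) g.
Proof.
rewrite /hword big_cat big_cons /= hV_sum hscale_suml hscale_sumr hscale_suml.
by apply: eq_bigr => j _; rewrite big_cat big_cons /= !mulrA.
Qed.

(** The group elements produced by the bracket are pushed to the right through [s2], so every
    correction term is a word with two vectors fewer. *)
Lemma hword_swap s1 v w s2 g :
  hword (s1 ++ v :: w :: s2) g = hword (s1 ++ w :: v :: s2) g
    + \sum_x kappa v w x *: hword (s1 ++ map (mulmx (rho x)) s2) (x * g).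
Proof.
have comm : hV v * hV w = hV w * hV v + \sum_x kappa v w x *: hT x.
  by rewrite -[\sum_x _](hVV rho kappa v w) /comm_br addrC subrK.
rewrite /hword !big_cat !big_cons /= [hV v * (_ * _)]mulrA comm.
rewrite mulrDl !mulrDr mulrDl.
rewrite -[hV w * hV v * _]mulrA; congr (_ + _).
rewrite hscale_suml hscale_sumr hscale_suml; apply: eq_bigr => x _.
by rewrite big_cat big_map hTM hT_prod !mulrA.
Qed.

Variable u : m.-tuple 'cV[K]_m.
Local Notation spanned := (formally_spanned (pbw_monomial rho kappa u)).

Section Step.
Variable d : nat.
Hypothesis shorter : forall s g, (size s < d)%N -> spanned (hword s g).

(** With [shorter] as induction hypothesis, the corrections in [hword_swap] are spanned and
    neighbouring vectors may be exchanged. *)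
Lemma spanned_swap s1 v w s2 g : (size (s1 ++ v :: w :: s2) <= d)%N ->
  spanned (hword (s1 ++ w :: v :: s2) g) -> spanned (hword (s1 ++ v :: w :: s2) g).
Proof.
move=> szd wS; rewrite hword_swap -[X in X + _]scale1r.
apply: formally_spannedP => //; apply: formally_spanned_sum => x; apply: shorter.
move: szd; rewrite !size_cat size_map /=; apply: leq_trans.
by rewrite ltn_add2l ltnS.
Qed.

Lemma spanned_front r s1 v s2 g : (size (r ++ s1 ++ v :: s2) <= d)%N ->
  spanned (hword (r ++ v :: s1 ++ s2) g) -> spanned (hword (r ++ s1 ++ v :: s2) g).
Proof.
elim: s1 r => // w s1 IHs r szd vS; rewrite cat_cons -cat_rcons.
apply: IHs; first by rewrite cat_rcons.
rewrite cat_rcons; apply: spanned_swap => //.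
by move: szd; rewrite !size_cat /= !size_cat /= addnS.
Qed.

(** The prefix [r] holds the letters already in place; the head of [s] is located in [t], brought to
    the front of [t] and appended to [r]. *)
Lemma spanned_perm r s t g : perm_eq s t -> (size (r ++ s) <= d)%N ->
  spanned (hword (r ++ s) g) -> spanned (hword (r ++ t) g).
Proof.
elim: s r t => [|v s IHs] r t.
  by move=> st szd; have /perm_size/esym/size0nil -> := st.
move=> st szd; have vt : v \in t by rewrite -(perm_mem st) mem_head.
case/splitPr: vt st => t1 t2.
rewrite perm_sym -cat1s perm_catCA perm_cons perm_sym => st vS.
apply: spanned_front.
  by move: szd; rewrite !size_cat /= (perm_size st) size_cat !addnS.
by rewrite -cat_rcons; apply: IHs => //; rewrite cat_rcons.
Qed.

Lemma spanned_basis_word (js : seq 'I_m) g : (size js <= d)%N ->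
  spanned (hword (map (tnth u) js) g).
Proof.
move=> szd; pose p := [ffun i => count_mem i js].
have pjs : perm_eq (exponent_word p) js.
  by apply/allP=> i _ /=; rewrite count_exponent_word ffunE.
apply: (@spanned_perm [::] _ _ _ (perm_map (tnth u) pjs)).
  by rewrite size_map (perm_size pjs).
have -> : hword (map (tnth u) (exponent_word p)) g =
    pbw_monomial rho kappa u (p, g).
  by rewrite /hword /pbw_monomial prod_exponent_word big_map.
exact: formally_spanned_gen.
Qed.

Hypothesis u_basis : basis_of fullv u.

(** The vectors are expanded in the basis [u] one at a time, and [js] records the indices chosen so
    far; the length of the word does not change. *)
Lemma spanned_mixed_word s (js : seq 'I_m) g : (size js + size s <= d)%N ->
  spanned (hword (map (tnth u) js ++ s) g).
Proof.
elim: s js => [|v s IHs] js szd.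
  by rewrite cats0; apply: spanned_basis_word; rewrite -[size js]addn0.
rewrite (coord_basis u_basis (memvf v)) hword_sum.
apply: formally_spanned_sum => j; rewrite -tnth_nth -cat_rcons -map_rcons.
by apply: IHs; rewrite size_rcons addSnnS.
Qed.

End Step.

Lemma hword_spanned s g : basis_of fullv u -> spanned (hword s g).
Proof.
move=> u_basis; have [d] := ubnP (size s); elim: d s g => // d IHd s g szd.
exact: (@spanned_mixed_word d IHd u_basis s [::]).
Qed.

Lemma pbw_spanned a : basis_of fullv u -> spanned a.
Proof.
move=> u_basis; elim/presalg_ind: a => [|c w y yS]; first exact: formally_spanned0.
apply: formally_spannedP => //; have [s [g ->]] := prod_presgenE w.
exact: hword_spanned.
Qed.

End Spanning.

(** * Brackets, and commutation of the shifted vectors *)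

Section CommutatorBracket.
Variable A : pzRingType.
Implicit Types a b c : A.

Lemma comm_brC a b : comm_br a b = - comm_br b a.
Proof. by rewrite /comm_br opprB. Qed.

Lemma comm_brBl a b c : comm_br (a - b) c = comm_br a c - comm_br b c.
Proof. by rewrite /comm_br mulrBl mulrBr opprD addrACA -opprD. Qed.

Lemma comm_brBr a b c : comm_br a (b - c) = comm_br a b - comm_br a c.
Proof.
by rewrite comm_brC comm_brBl opprB (comm_brC a b) (comm_brC a c) opprK addrC.
Qed.

End CommutatorBracket.

Section GroupAlgebraScaling.
Variables (K : fieldType) (gT : finGroupType).
Implicit Types (x y : grpalg K gT).

Lemma grpalg_scaleAl (c : K) x y : c *: (x * y) = (c *: x) * y.
Proof.
apply/ffunP=> g; rewrite [LHS]ffunE !gmulE [LHS]mulr_sumr.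
by apply: eq_bigr => z _; rewrite ffunE mulrA.
Qed.

HB.instance Definition _ :=
  GRing.Lmodule_isLalgebra.Build K (grpalg K gT) grpalg_scaleAl.

Lemma grpalg_scaleAr (c : K) x y : c *: (x * y) = x * (c *: y).
Proof.
apply/ffunP=> g; rewrite [LHS]ffunE !gmulE [LHS]mulr_sumr.
by apply: eq_bigr => z _; rewrite ffunE mulrCA.
Qed.

HB.instance Definition _ :=
  GRing.Lalgebra_isAlgebra.Build K (grpalg K gT) grpalg_scaleAr.

End GroupAlgebraScaling.

Section HeckeTilde.
Variables (K : fieldType) (gT : finGroupType) (m : nat).
Variable rho : mx_representation K [set: gT] m.
Variable kappa : 'cV[K]_m -> 'cV[K]_m -> grpalg K gT.
Local Notation A := (hecke_alg rho kappa).
Local Notation hV := (hV rho kappa).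
Local Notation hT := (hT rho kappa).
Local Notation hW := (hW rho kappa).

Lemma hWP c x y : hW (c *: x + y) = c *: hW x + hW y.
Proof.
rewrite /Defs.hW scaler_sumr -big_split; apply: eq_bigr => g _.
by rewrite !ffunE scalerDl scalerA.
Qed.

Lemma hW0 : hW 0 = 0.
Proof. by rewrite /Defs.hW big1 // => g _; rewrite ffunE scale0r. Qed.

Lemma hWD x y : hW (x + y) = hW x + hW y.
Proof. by rewrite -[x]scale1r hWP !scale1r. Qed.

Lemma hWZ c x : hW (c *: x) = c *: hW x.
Proof. by rewrite -[c *: x]addr0 hWP hW0 addr0. Qed.

Lemma hWN x : hW (- x) = - hW x.
Proof. by rewrite -scaleN1r hWZ scaleN1r. Qed.

Lemma hW_gbase g : hW (gbase g) = hT g.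
Proof.
rewrite /Defs.hW (bigD1 g) //= ffunE eqxx scale1r big1 ?addr0 // => i /negPf ig.
by rewrite ffunE ig scale0r.
Qed.

Lemma hW1 : hW 1 = 1.
Proof. by rewrite -(hT1 rho kappa) -hW_gbase. Qed.

Lemma hT_hW g x : hT g * hW x = hW (gbase g * x).
Proof.
rewrite /Defs.hW hscale_sumr [RHS](reindex_inj (mulgI g)); apply: eq_bigr => z _.
by rewrite gbase_mulE mulKg hTM.
Qed.

Lemma hW_hT x g : hW x * hT g = hW (x * gbase g).
Proof.
rewrite /Defs.hW hscale_suml [RHS](reindex_inj (mulIg g)); apply: eq_bigr => z _.
by rewrite mul_gbaseE mulgK hTM.
Qed.

Lemma hWM x y : hW (x * y) = hW x * hW y.
Proof.
rewrite {1}[x]gbase_sum mulr_suml (big_morph hW hWD hW0) {2}/Defs.hW hscale_suml.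
by apply: eq_bigr => g _; rewrite -scalerAl hWZ hT_hW.
Qed.

Lemma hW_comm x y : hW (comm_br x y) = comm_br (hW x) (hW y).
Proof. by rewrite /comm_br hWD hWN !hWM. Qed.

(** For a single group element, v t_g - t_g v = (v - g v) t_g. This exhibits the vectors to which
    [h_sym] applies. *)
Lemma hV_hW_comm v x :
  comm_br (hV v) (hW x) = \sum_g hV (x g *: (v - rho g *m v)) * hT g.
Proof.
rewrite /comm_br /Defs.hW hscale_suml hscale_sumr -sumrB; apply: eq_bigr => g _.
have hVZ c w : hV (c *: w) = c *: hV w.
  by rewrite -[c *: w]addr0 hV_linear hV0 addr0.
have hVB w1 w2 : hV (w1 - w2) = hV w1 - hV w2.
  by rewrite addrC -scaleN1r hV_linear scaleN1r addrC.
rewrite hVZ hVB -presalg_scaleAl mulrBl hTV.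
exact/esym/scalerBr.
Qed.

Variable h : 'cV[K]_m -> grpalg K gT.
Hypothesis h_sym : forall x (v w : 'cV[K]_m),
  h v x *: (w - rho x *m w) = h w x *: (v - rho x *m v).
Hypothesis kappaE : forall v w, kappa v w = - comm_br (h v) (h w).

(** The two mixed brackets cancel by [h_sym], and the defining relation of the algebra makes [v, w]
    cancel [h v, h w]. *)
Lemma shifted_comm v w : comm_br (hV v - hW (h v)) (hV w - hW (h w)) = 0.
Proof.
have sym : comm_br (hV v) (hW (h w)) = comm_br (hV w) (hW (h v)).
  by rewrite !hV_hW_comm; apply: eq_bigr => g _; rewrite h_sym.
have VV : comm_br (hV v) (hV w) = - comm_br (hW (h v)) (hW (h w)).
  by rewrite hVV kappaE hWN hW_comm.
rewrite comm_brBl [X in X - _]comm_brBr [X in _ - X]comm_brBr VV sym.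
by rewrite (comm_brC (hW (h v)) (hV w)) [X in X - _]addrC; exact: subrr.
Qed.

End HeckeTilde.

(** * Roots and simple reflections *)

Local Notation form := Defs.form.

Section BilinearForm.
Variables (K : comNzRingType) (m : nat) (B : 'M[K]_m).
Implicit Types (a v w : 'cV[K]_m).

Lemma bformZr c v w : form B v (c *: w) = c * form B v w.
Proof. by rewrite /form -scalemxAr mxE. Qed.

Lemma bformNr v w : form B v (- w) = - form B v w.
Proof. by rewrite /form mulmxN mxE. Qed.

Lemma bformDl v1 v2 w : form B (v1 + v2) w = form B v1 w + form B v2 w.
Proof. by rewrite /form linearD /= !mulmxDl mxE. Qed.

Lemma bformZl c v w : form B (c *: v) w = c * form B v w.
Proof. by rewrite /form linearZ /= -!scalemxAl mxE. Qed.

Lemma bformNl v w : form B (- v) w = - form B v w.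
Proof. by rewrite /form linearN /= !mulNmx mxE. Qed.

Lemma form_suml (J : Type) (r : seq J) (F : J -> 'cV[K]_m) w :
  form B (\sum_(j <- r) F j) w = \sum_(j <- r) form B (F j) w.
Proof.
elim/big_rec2: _ => [|j x v _ <-]; last exact: bformDl.
by rewrite /form trmx0 !mul0mx mxE.
Qed.

Lemma bformC v w : B^T = B -> form B v w = form B w v.
Proof.
move=> BT; have vwT : v^T *m B *m w = (w^T *m B *m v)^T.
  by rewrite !trmx_mul trmxK BT mulmxA.
by rewrite /form vwT mxE.
Qed.

(** Makes the formula of a reflection a matrix identity, which can be carried entrywise to a larger
    field. *)
Lemma form_scaleE v w a : B^T = B -> form B v w *: a = a *m (w^T *m B) *m v.
Proof.
move=> BT; rewrite bformC // -mulmxA (mx11_scalar (w^T *m B *m v)).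
by rewrite mul_mx_scalar.
Qed.

End BilinearForm.

Lemma mulmx_inj (K : comNzRingType) (m n : nat) (M N : 'M[K]_(m, n)) :
  (forall v : 'cV[K]_n, M *m v = N *m v) -> M = N.
Proof.
move=> MN; apply/matrixP=> i j; have /matrixP/(_ i 0) := MN (delta_mx j 0).
by rewrite -!colE !mxE.
Qed.

Section RootSystem.
Variables (R : realType) (gT : finGroupType) (m n : nat).
Variables (rho : mx_representation R [set: gT] m) (B : 'M[R]_m).
Variables (Phi : {fset 'cV[R]_m}) (Delta : n.-tuple 'cV[R]_m).
Hypothesis W_refl : reflection_group rho.
Hypothesis B_inner : invariant_inner_product rho B.
Hypothesis Phi_root : root_system rho B Phi.
Hypothesis Delta_simple : simple_system Phi Delta.

Local Notation refl := (refl_elt rho B).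
Local Notation pos := (positive Delta).
Local Notation coroot := (coroot B).
Implicit Types (a b v w : 'cV[R]_m) (g x : gT).

Let BT : B^T = B. Proof. by case: B_inner. Qed.

Lemma form_gt0 a : a != 0 -> 0 < form B a a.
Proof. by case: B_inner => _ + _; exact. Qed.

Lemma form_invariant g v w : form B (rho g *m v) (rho g *m w) = form B v w.
Proof. by case: B_inner. Qed.

Lemma rho_inj g x : (forall v, rho g *m v = rho x *m v) -> g = x.
Proof.
case: W_refl => faith _ /mulmx_inj gx.
by apply: (mx_faithful_inj faith) gx; rewrite in_setT.
Qed.

Lemma coroot_rho g a : coroot (rho g *m a) = rho g *m coroot a.
Proof. by rewrite /Defs.coroot form_invariant scalemxAr. Qed.

Lemma corootN a : coroot (- a) = - coroot a.
Proof. by rewrite /Defs.coroot bformNl bformNr opprK scalerN. Qed.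

Lemma form_coroot a : a != 0 -> form B a (coroot a) = 2.
Proof. by move=> a0; rewrite bformZr divfK // gt_eqF ?form_gt0. Qed.

Lemma acts_as_refl_mx g a : acts_as_refl rho B g a <->
  rho g = 1%:M - a *m ((coroot a)^T *m B).
Proof.
split=> [ga|ga v]; last by rewrite ga mulmxBl mul1mx -form_scaleE.
by apply: mulmx_inj => v; rewrite ga mulmxBl mul1mx -form_scaleE.
Qed.

Lemma acts_as_refl_inj g x a :
  acts_as_refl rho B g a -> acts_as_refl rho B x a -> g = x.
Proof. by move=> ga xa; apply: rho_inj => v; rewrite ga xa. Qed.

Lemma refl_eltE g a : acts_as_refl rho B g a -> refl a = g.
Proof.
move=> ga; rewrite /refl_elt; case: pickP => [x /asboolP xa|/(_ g)/asboolP //].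
exact: acts_as_refl_inj xa ga.
Qed.

Lemma root_neq0 a : a \in Phi -> a != 0.
Proof. by case: Phi_root => + _ _ => /[apply] -[]. Qed.

Lemma refl_eltP a : a \in Phi -> acts_as_refl rho B (refl a) a.
Proof.
case: Phi_root => + _ _ => /[apply] -[_ [g ga]].
by rewrite (refl_eltE ga).
Qed.

Lemma root_rho g a : a \in Phi -> rho g *m a \in Phi.
Proof. by case: Phi_root => _ + _; exact. Qed.

Lemma refl_root a : a \in Phi -> rho (refl a) *m a = - a.
Proof.
move=> aP; rewrite refl_eltP // form_coroot ?root_neq0 //.
by rewrite scaler_nat mulr2n opprD addNKr.
Qed.

Lemma root_opp a : a \in Phi -> - a \in Phi.
Proof. by move=> aP; rewrite -refl_root // root_rho. Qed.

Lemma refl_rho g a : a \in Phi -> refl (rho g *m a) = (refl a ^ g^-1)%g.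
Proof.
move=> aP; apply: refl_eltE => v.
rewrite conjgE invgK !repr_actM refl_eltP // mulmxBr -scalemxAr.
rewrite repr_actVK coroot_rho.
by rewrite -[in form B _ (coroot a)](form_invariant g) repr_actVK.
Qed.

Lemma refl_opp a : a \in Phi -> refl (- a) = refl a.
Proof.
move=> aP; apply: refl_eltE => v.
by rewrite corootN bformNr scalerN scaleNr opprK refl_eltP.
Qed.

Lemma refl_mulK a v : a \in Phi -> rho (refl a) *m (rho (refl a) *m v) = v.
Proof.
move=> aP; have {2}-> : v = rho (refl a) *m v + form B v (coroot a) *: a.
  by rewrite refl_eltP // subrK.
rewrite [X in rho _ *m X]refl_eltP // mulmxBr -scalemxAr refl_root // scalerN.
by rewrite opprK.
Qed.

Lemma refl_mulg a : a \in Phi -> (refl a * refl a = 1)%g.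
Proof.
move=> aP; apply: rho_inj => v.
by rewrite repr_actM refl_mulK // repr_mx1 mul1mx.
Qed.

(** The matrix minus the identity is a column times a row, so its rank is at most 1; it is not zero
    because [a] is sent to [- a]. *)
Lemma reflection_refl a : a \in Phi -> reflection_mx (rho (refl a)).
Proof.
move=> aP; rewrite /reflection_mx eqn_leq; apply/andP; split.
  have /acts_as_refl_mx -> := refl_eltP aP.
  rewrite addrAC subrr sub0r mxrank_opp.
  by rewrite (leq_trans (mxrankM_maxl _ _)) ?rank_leq_col.
rewrite lt0n mxrank_eq0 subr_eq0; apply/eqP=> r1.
have := refl_root aP; rewrite r1 mul1mx => /eqP.
rewrite -addr_eq0 -mulr2n -scaler_nat scaler_eq0 pnatr_eq0.
by rewrite (negPf (root_neq0 aP)).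
Qed.

(** By the last clause of [root_system], the roots of a given reflection are one vector and its
    opposite. *)
Lemma root_same_refl a b :
  a \in Phi -> b \in Phi -> refl a = refl b -> a = b \/ a = - b.
Proof.
move=> aP bP ab; case: Phi_root => _ _ /(_ _ (reflection_refl bP)) [c cP].
have /cP ca : a \in Phi /\ acts_as_refl rho B (refl b) a.
  by rewrite -ab; split=> //; exact: refl_eltP.
have /cP cb : b \in Phi /\ acts_as_refl rho B (refl b) b.
  by split=> //; exact: refl_eltP.
case: ca cb => -> [] ->; rewrite ?opprK; by [left|right].
Qed.

Local Notation alpha i := (tnth Delta i).

Lemma simple_root i : alpha i \in Phi. Proof. by case: Delta_simple. Qed.

Let Delta_free : free Delta. Proof. by case: Delta_simple. Qed.

Lemma pos_or_neg a : a \in Phi -> pos a || pos (- a).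
Proof. by case: Delta_simple => _ _; exact. Qed.

Lemma coord_alpha i j : coord Delta j (alpha i) = (j == i)%:R.
Proof. by rewrite (tnth_nth 0) coord_free // eq_sym. Qed.

Lemma alpha_span i : alpha i \in <<Delta>>%VS.
Proof. by rewrite memv_span // mem_tnth. Qed.

Lemma pos_simple i : pos (alpha i).
Proof.
rewrite /positive alpha_span; apply/forallP=> j.
by rewrite coord_alpha ler0n.
Qed.

Lemma pos_opp a : a != 0 -> pos a -> ~~ pos (- a).
Proof.
move=> a0 /andP[aD /forallP a_ge0]; apply/negP=> /andP[_ /forallP a_le0].
case/negP: a0; apply/eqP; rewrite (coord_span aD) big1 // => j _.
apply/eqP; rewrite scaler_eq0; apply/orP; left.
rewrite eq_le a_ge0 andbT; have := a_le0 j.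
by rewrite linearN oppr_ge0.
Qed.

(** The coordinates of a root never have opposite signs, so one positive coordinate decides. *)
Lemma posN_coord a j : a \in Phi -> 0 < coord Delta j a -> pos a.
Proof.
move=> aP aj; case/orP: (pos_or_neg aP) => // /andP[_ /forallP/(_ j)].
by rewrite linearN oppr_ge0 leNgt aj.
Qed.

(** Such a root is a multiple of [alpha i] and has the same reflection, so it is [alpha i] up to
    sign, and positivity fixes the sign. *)
Lemma pos_simple_line a i : a \in Phi -> pos a ->
  (forall j, j != i -> coord Delta j a = 0) -> a = alpha i.
Proof.
move=> aP ap aj0; have aE : a = coord Delta i a *: alpha i.
  have /andP[aD _] := ap; rewrite {1}(coord_span aD) (bigD1 i) //=.
  rewrite big1 ?addr0 -?tnth_nth //.
  by move=> j ji; rewrite aj0 // scale0r.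
set c := coord Delta i a in aE.
have c0 : c != 0 by apply: contraNneq (root_neq0 aP) => c0; rewrite aE c0 scale0r.
have same : refl a = refl (alpha i).
  apply: refl_eltE => v; rewrite refl_eltP ?simple_root //; congr (_ - _).
  have f0 : form B (alpha i) (alpha i) != 0.
    by rewrite gt_eqF // form_gt0 // root_neq0 // simple_root.
  rewrite [in RHS]aE /Defs.coroot !(bformZl, bformZr) !scalerA; congr (_ *: _).
  by field; rewrite c0 f0.
case: (root_same_refl aP (simple_root i) same) => // aN.
have := pos_opp (root_neq0 (simple_root i)) (pos_simple i).
by rewrite -aN ap.
Qed.

(** The reflection changes only the coordinate at [i], and by [pos_simple_line] some other
    coordinate of [a] is positive. *)
Lemma simple_refl_pos a i : a \in Phi -> pos a -> a != alpha i ->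
  pos (rho (refl (alpha i)) *m a).
Proof.
move=> aP ap ai; have saP := root_rho (refl (alpha i)) aP.
have [/existsP [j /andP[ji aj]]|noj] :=
    boolP [exists j, (j != i) && (coord Delta j a != 0)].
  apply: (@posN_coord _ j saP); rewrite refl_eltP ?simple_root //.
  rewrite linearB linearZ /= coord_alpha (negPf ji) mulr0 subr0 lt_def aj /=.
  by case/andP: ap => _ /forallP.
case/eqP: ai; apply: pos_simple_line => // j ji; apply/eqP.
move: noj; rewrite negb_exists => /forallP/(_ j).
by rewrite ji /= negbK.
Qed.

Local Notation other_roots i := [seq a <- Phi | pos a && (a != alpha i)].

(** An involution that maps a finite set into itself permutes it. A root sent to [alpha i] would be
    [- alpha i], which is not positive. *)
Lemma perm_simple_refl i :
  perm_eq [seq rho (refl (alpha i)) *m a | a <- other_roots i] (other_roots i).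
Proof.
set s := rho _; have sK : involutive (mulmx s : 'cV_m -> 'cV_m).
  by move=> v; exact: refl_mulK (simple_root i).
have stable a : a \in Phi -> pos a -> a != alpha i ->
    [/\ s *m a \in Phi, pos (s *m a) & s *m a != alpha i].
  move=> aP ap ai; split; [exact: root_rho|exact: simple_refl_pos|].
  apply: contraTneq ap => sa; rewrite -[a]sK sa /s refl_root ?simple_root //.
  exact: pos_opp (root_neq0 (simple_root i)) (pos_simple i).
apply: uniq_perm; rewrite ?map_inj_uniq ?filter_uniq ?fset_uniq //.
  exact: inv_inj.
move=> b; apply/mapP/idP => [[a + ->]|].
  rewrite !mem_filter => /andP[/andP[ap ai] aP].
  by have [-> -> ->] := stable a aP ap ai.
rewrite mem_filter => /andP[/andP[bp bi] bP]; exists (s *m b); last by rewrite sK.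
by rewrite mem_filter; have [-> -> ->] := stable b bP bp bi.
Qed.

(* Descent: among the positive roots of the form g a with g in the subgroup H,
   one of least height is simple. *)
Lemma simple_refl_gen : <<[set refl (alpha i) | i : 'I_n]>>%g = [set: gT].
Proof.
set H := <<_>>%g.
have sH i : refl (alpha i) \in H by rewrite mem_gen //; apply/imsetP; exists i.
have posH a : a \in Phi -> pos a -> refl a \in H.
  move=> aP ap; pose ht b : R := \sum_i coord Delta i b.
  have ht_sub b c i : ht (b - c *: alpha i) = ht b - c.
    rewrite /ht (eq_bigr (fun j => coord Delta j b - c * (j == i)%:R)) => [|j _].
      rewrite sumrB -mulr_sumr; congr (_ - _).
      by rewrite (bigD1 i) //= eqxx big1 ?addr0 ?mulr1 // => j /negPf ->.
    by rewrite linearB linearZ /= coord_alpha.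
  have P1 : (1%g \in H) && pos (rho 1%g *m a) by rewrite group1 repr_mx1 mul1mx.
  have [g /andP[gH gp] g_min] := @arg_minP _ _ _ 1%g
    (fun g => (g \in H) && pos (rho g *m a)) (fun g => ht (rho g *m a)) P1.
  set b := rho g *m a in gp g_min; have bP : b \in Phi by exact: root_rho.
  (* Otherwise, expanding [0 < form B b b] over the simple roots yields some [alpha i] pairing
     positively with [b]; its reflection keeps [b] positive and lowers the height, against
     minimality. *)
  have [i bi] : exists i, b = alpha i.
    have [/existsP [i /eqP bi]|/existsPn b_ne] := boolP [exists i, b == alpha i].
      by exists i.
    have : 0 < form B b b by rewrite form_gt0 // root_neq0.
    have /andP[bD /forallP b_ge0] := gp.
    rewrite {1}(coord_span bD) form_suml ltNge; case/negP.
    apply: sumr_le0 => i _; rewrite bformZl -tnth_nth mulr_ge0_le0 //.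
    rewrite leNgt; apply/negP=> bi_gt0.
    have := g_min (refl (alpha i) * g)%g; rewrite groupM // repr_actM.
    rewrite simple_refl_pos // => /(_ isT); rewrite -/b refl_eltP ?simple_root //.
    rewrite ht_sub leNgt => /negP; apply.
    rewrite ltrBlDr ltrDl /Defs.coroot bformZr (bformC _ _ BT) mulr_gt0 //.
    by rewrite divr_gt0 ?ltr0n // form_gt0 // root_neq0 // simple_root.
  have -> : refl a = (refl b ^ g)%g by rewrite refl_rho // conjgKV.
  by rewrite groupJ // bi.
(* The group is generated by its reflections, each of which belongs to a root that may be chosen
   positive. *)
apply/eqP; rewrite eqEsubset subsetT /=; case: W_refl => _ <-.
rewrite gen_subG; apply/subsetP=> g; rewrite inE => g_refl.
case: Phi_root => _ _ /(_ _ g_refl) [a aP].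
have [aPhi ga] := (aP a).2 (or_introl erefl); rewrite -(refl_eltE ga).
case/orP: (pos_or_neg aPhi) => [ap|an]; first exact: posH.
by rewrite -refl_opp //; apply: posH => //; exact: root_opp.
Qed.

End RootSystem.

(** * The elements h v of the group algebra and their brackets *)

Lemma form_mx_inj (K : comNzRingType) (m : nat) (M N : 'M[K]_m) :
  (forall v w, form M v w = form N v w) -> M = N.
Proof.
move=> MN; apply/matrixP=> i j; have := MN (delta_mx i 0) (delta_mx j 0).
by rewrite /form !trmx_delta -!rowE -!colE !mxE.
Qed.

(* The field of complex numbers is replaced by an arbitrary extension f of R:
   unification must not unfold complex arithmetic. *)
Section ReflectionPairing.
Variables (R : realType) (K : fieldType) (f : {rmorphism R -> K}).
Variables (gT : finGroupType) (m n : nat).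
Variables (rho : mx_representation R [set: gT] m) (B : 'M[R]_m).
Variables (Phi : {fset 'cV[R]_m}) (Delta : n.-tuple 'cV[R]_m) (k : 'cV[R]_m -> K).
Hypothesis W_refl : reflection_group rho.
Hypothesis B_inner : invariant_inner_product rho B.
Hypothesis Phi_root : root_system rho B Phi.
Hypothesis Delta_simple : simple_system Phi Delta.
Hypothesis k_inv : forall g a, a \in Phi -> k (rho g *m a) = k a.

Local Notation refl := (refl_elt rho B).
Local Notation pos := (positive Delta).
Local Notation coroot := (coroot B).
Local Notation alpha i := (tnth Delta i).
Local Notation rhoC := (map_repr f rho).
Local Notation BC := (map_mx f B).
Local Notation cvec := (map_mx f : 'cV[R]_m -> 'cV[K]_m).
Implicit Types (a b : 'cV[R]_m) (v w : 'cV[K]_m) (g x : gT).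

Definition coroot_pairing v a : K := form BC v (cvec (coroot a)).
Local Notation pairing := coroot_pairing.

Definition refl_term v a : grpalg K gT := (k a * pairing v a) *: gbase (refl a).
Local Notation term := refl_term.

Definition refl_sum v : grpalg K gT := 2^-1 *: \sum_(a <- Phi | pos a) term v a.
Local Notation h := refl_sum.

Definition refl_bracket v w : grpalg K gT := - comm_br (h v) (h w).
Local Notation kappa := refl_bracket.

Lemma cvec_rho g a : cvec (rho g *m a) = rhoC g *m cvec a.
Proof. exact: map_mxM. Qed.

Lemma cvecN a : cvec (- a) = - cvec a.
Proof. exact: map_mxN. Qed.

Let BCT : BC^T = BC.
Proof. by rewrite map_trmx; case: B_inner => ->. Qed.

(** Invariance on real vectors amounts to a matrix identity, which [f] preserves. *)
Lemma cform_invariant g v w : form BC (rhoC g *m v) (rhoC g *m w) = form BC v w.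
Proof.
have BE : (rho g)^T *m B *m rho g = B.
  apply: form_mx_inj => a b; rewrite -[RHS](form_invariant B_inner g).
  by rewrite /form trmx_mul !mulmxA.
have BCE : (rhoC g)^T *m BC *m rhoC g = BC.
  by rewrite -[in RHS]BE !map_mxM map_trmx.
by rewrite -[in RHS]BCE /form trmx_mul !mulmxA.
Qed.

Lemma pairing_rho g v a : pairing (rhoC g *m v) (rho g *m a) = pairing v a.
Proof. by rewrite /coroot_pairing (coroot_rho B_inner) cvec_rho cform_invariant. Qed.

Lemma pairing_opp v a : pairing v (- a) = - pairing v a.
Proof. by rewrite /coroot_pairing corootN cvecN [LHS]bformNr. Qed.

Lemma refl_complex a v : a \in Phi ->
  rhoC (refl a) *m v = v - pairing v a *: cvec a.
Proof.
move=> aP; have /(acts_as_refl_mx B_inner) rE := refl_eltP W_refl Phi_root aP.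
have -> : rhoC (refl a) = 1%:M - cvec a *m ((cvec (coroot a))^T *m BC).
  by rewrite [LHS](congr1 (map_mx (f)) rE) map_mxB map_mx1 !map_mxM map_trmx.
by rewrite mulmxBl mul1mx -form_scaleE.
Qed.

Lemma refl_sum_linear c v w : h (c *: v + w) = c *: h v + h w.
Proof.
rewrite /refl_sum scalerA mulrC -scalerA -scalerDr; congr (_ *: _).
rewrite scaler_sumr -big_split; apply: eq_bigr => a _.
rewrite /refl_term /coroot_pairing bformDl bformZl mulrDr scalerDl scalerA.
by rewrite mulrCA.
Qed.

Lemma refl_sum_entry v x :
  h v x = 2^-1 * \sum_(a <- Phi | pos a) k a * pairing v a * (x == refl a)%:R.
Proof.
rewrite /refl_sum ffunE sum_ffunE; congr (_ * _).
by apply: eq_bigr => a _; rewrite !ffunE.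
Qed.

(** If x is the reflection of a, then w - x w is the pairing of w with the coroot times a. Both
    sides are therefore one sum over the positive roots with reflection x, whose terms contain the
    product of the pairings of v and w. *)
Lemma refl_sum_sym x v w :
  h v x *: (w - rhoC x *m w) = h w x *: (v - rhoC x *m v).
Proof.
have hE v' w' : h v' x *: (w' - rhoC x *m w') =
    2^-1 *: \sum_(a <- Phi | pos a)
      (k a * (pairing v' a * pairing w' a) * (x == refl a)%:R) *: cvec a.
  rewrite refl_sum_entry -scalerA scaler_suml; congr (_ *: _).
  rewrite big_seq_cond [RHS]big_seq_cond; apply: eq_bigr => a /andP[aP _].
  have [->|_] := eqVneq x (refl a); last by rewrite !mulr0 !scale0r.
  by rewrite refl_complex // opprB addrC subrK !mulr1 scalerA mulrA.
rewrite [LHS]hE [RHS]hE; congr (_ *: _); apply: eq_bigr => a _.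
by rewrite [pairing v a * _]mulrC.
Qed.

Lemma term_conj g v a : a \in Phi ->
  gbase g * term v a * gbase g^-1%g = term (rhoC g *m v) (rho g *m a).
Proof.
move=> aP; rewrite /refl_term -scalerAr -scalerAl !gbaseM pairing_rho k_inv //.
by rewrite (refl_rho W_refl B_inner Phi_root) // conjgE invgK mulgA.
Qed.

Lemma term_opp v a : a \in Phi -> term v (- a) = - term v a.
Proof.
move=> aP; rewrite /refl_term pairing_opp (refl_opp W_refl Phi_root) //.
rewrite mulrN scaleNr.
by rewrite -(refl_root W_refl B_inner Phi_root aP) k_inv.
Qed.

Lemma sum_pos_split (A : nmodType) i (F : 'cV[R]_m -> A) :
  \sum_(a <- Phi | pos a) F a =
  F (alpha i) + \sum_(a <- [seq a <- Phi | pos a && (a != alpha i)]) F a.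
Proof.
rewrite -big_filter (bigD1_seq (alpha i)) ?filter_uniq ?fset_uniq //=; last first.
  by rewrite mem_filter (pos_simple Delta_simple) (simple_root Delta_simple).
congr (_ + _); rewrite -big_filter -filter_predI.
by congr bigop; apply: eq_filter => a /=; rewrite andbC.
Qed.

Let coef i v := k (alpha i) * pairing v (alpha i).

(** Conjugation by [s] permutes the terms of the other positive roots and sends the term of
    [alpha i] to that of its negative. This sign change costs twice one half of
    [coef i v *: gbase s]. *)
Lemma refl_sum_conj i v : let s := refl (alpha i) in
  gbase s * h v * gbase s = h (rhoC s *m v) + coef i v *: gbase s.
Proof.
move=> s; have aP := simple_root Delta_simple i.
have sV : (s^-1 = s)%g.
  by apply/eqP; rewrite eq_invg_mul (refl_mulg W_refl B_inner Phi_root).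
rewrite -{2}sV /refl_sum -scalerAr -scalerAl mulr_sumr mulr_suml.
have -> : \sum_(a <- Phi | pos a) gbase s * term v a * gbase s^-1%g =
    \sum_(a <- Phi | pos a) term (rhoC s *m v) (rho s *m a).
  rewrite big_seq_cond [RHS]big_seq_cond; apply: eq_bigr => a /andP[aPhi _].
  exact: term_conj.
rewrite (sum_pos_split i) -(big_map (mulmx (rho s)) xpredT (term (rhoC s *m v))).
rewrite (perm_big _ (perm_simple_refl W_refl B_inner Phi_root Delta_simple i)).
rewrite (sum_pos_split i (term (rhoC s *m v))).
rewrite (refl_root W_refl B_inner Phi_root aP).
rewrite term_opp //.
have -> : term (rhoC s *m v) (alpha i) = - (coef i v *: gbase s).
  rewrite /refl_term /coef -scaleNr -mulrN; congr ((_ * _) *: _).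
  rewrite -[alpha i in LHS]opprK -(refl_root W_refl B_inner Phi_root aP) -/s.
  by rewrite pairing_opp pairing_rho.
rewrite opprK; set S := \sum_(_ <- _) _; set c := coef i v *: _.
have two_neq0 : (2 : K) != 0 by rewrite -(rmorph_nat f) fmorph_eq0 pnatr_eq0.
have cE : c = 2^-1 *: (c + c).
  by rewrite -mulr2n -scaler_nat scalerA mulVf // scale1r.
rewrite [X in _ = _ + X]cE -scalerDr; congr (_ *: _).
by rewrite addrACA addNr add0r addrC.
Qed.

Lemma refl_mul_refl_sum i v : let s := refl (alpha i) in
  gbase s * h v = h (rhoC s *m v) * gbase s + coef i v *: 1.
Proof.
move=> s; have aP := simple_root Delta_simple i.
have ss : gbase s * gbase s = 1 :> grpalg K gT.
  by rewrite gbaseM (refl_mulg W_refl B_inner Phi_root).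
rewrite -[LHS]mulr1 -ss mulrA refl_sum_conj mulrDl.
by rewrite -[X in _ + X = _]scalerAl.
Qed.

(** Substitute [hs] and expand. The mixed terms involve the bracket of t (h u) t with t, which by
    [comm_t] is the pairing of u with the simple coroot times an element independent of u; the two
    mixed terms then have opposite coefficients. *)
Lemma refl_bracket_simple i v w : let s := refl (alpha i) in
  kappa (rhoC s *m v) (rhoC s *m w) = gbase s * kappa v w * gbase s^-1%g.
Proof.
move=> s; have aP := simple_root Delta_simple i.
have sg : (s * s = 1)%g by exact: (refl_mulg W_refl B_inner Phi_root).
have sV : (s^-1 = s)%g by apply/eqP; rewrite eq_invg_mul sg.
set t : grpalg K gT := gbase s; have tt : t * t = 1 by rewrite gbaseM sg.
have hs u : h (rhoC s *m u) = t * h u * t - coef i u *: t.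
  by rewrite refl_sum_conj addrK.
have comm_t u : comm_br (t * h u * t) t = pairing u (alpha i) *:
    (k (alpha i) *: 1 - h (cvec (alpha i)) * t).
  rewrite /comm_br -(mulrA (t * h u) t t) tt mulr1 !mulrA tt mul1r.
  rewrite refl_mul_refl_sum.
  rewrite refl_complex //.
  have -> : h (u - pairing u (alpha i) *: cvec (alpha i)) =
      h u - pairing u (alpha i) *: h (cvec (alpha i)).
    by rewrite addrC -scaleNr refl_sum_linear scaleNr addrC.
  rewrite mulrBl addrAC [h u * t - _ - _]addrAC subrr sub0r addrC -scalerAl.
  by rewrite /coef mulrC -scalerA -scalerBr.
have commtt : comm_br t t = 0 by exact: subrr.
have commZr c y z : comm_br y (c *: z) = c *: comm_br y z :> grpalg K gT.
  by rewrite /comm_br -scalerAr -scalerAl scalerBr.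
have commZl c y z : comm_br (c *: y) z = c *: comm_br y z :> grpalg K gT.
  by rewrite /comm_br -scalerAr -scalerAl scalerBr.
have comm_conj (y z : grpalg K gT) :
    comm_br (t * y * t) (t * z * t) = t * comm_br y z * t.
  rewrite /comm_br mulrBr mulrBl !mulrA.
  by congr (_ - _); rewrite -!mulrA (mulrA t t) tt mul1r.
rewrite sV /refl_bracket mulrN mulNr -comm_conj; congr (- _).
rewrite !hs comm_brBl !comm_brBr !commZl !commZr commtt !scaler0 subr0.
rewrite (comm_brC t) !comm_t scalerN opprK.
set r := _ - h _ * t; have -> : coef i v *: (pairing w (alpha i) *: r) =
    coef i w *: (pairing v (alpha i) *: r).
  by rewrite !scalerA /coef mulrAC.
exact: subrK.
Qed.

(** The group elements with this property form a subgroup, and it contains the simple reflections,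
    which generate. *)
Lemma refl_bracket_conj g v w :
  kappa (rhoC g *m v) (rhoC g *m w) = gbase g * kappa v w * gbase g^-1%g.
Proof.
pose P x := `[< forall v w, kappa (rhoC x *m v) (rhoC x *m w) =
  gbase x * kappa v w * gbase x^-1%g >].
have gP : group_set [set x | P x].
  apply/group_setP; split=> [|x y].
    rewrite inE; apply/asboolP=> v' w'.
    by rewrite invg1 repr_mx1 !mul1mx -[gbase 1%g]/(1 : grpalg K gT) mul1r mulr1.
  rewrite !inE => /asboolP xP /asboolP yP; apply/asboolP=> v' w'.
  by rewrite !repr_actM xP yP invMg -!gbaseM !mulrA.
have : g \in group gP.
  have : g \in <<[set refl (alpha i) | i : 'I_n]>>%g.
    by rewrite (simple_refl_gen W_refl B_inner Phi_root Delta_simple) in_setT.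
  apply/subsetP; rewrite gen_subG; apply/subsetP=> _ /imsetP[i _ ->].
  by rewrite inE; apply/asboolP=> v' w'; exact: refl_bracket_simple.
by rewrite inE => /asboolP; exact.
Qed.

Lemma refl_bracket_equivariant g v w x :
  kappa (rhoC g *m v) (rhoC g *m w) x = kappa v w (x ^ g)%g.
Proof.
by rewrite refl_bracket_conj mul_gbaseE gbase_mulE invgK conjgE mulgA.
Qed.

Lemma refl_bracket_skew : skew_forms kappa.
Proof.
move=> g; split=> [c u v w|v w]; last first.
  by rewrite /refl_bracket comm_brC !ffunE.
rewrite /refl_bracket refl_sum_linear.
have commP (x y z : grpalg K gT) :
    comm_br (c *: x + y) z = c *: comm_br x z + comm_br y z.
  by rewrite /comm_br mulrDl mulrDr -scalerAl -scalerAr scalerBr opprD addrACA.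
rewrite commP.
have scaleE (x : grpalg K gT) : (c *: x) g = c * x g by rewrite ffunE.
by rewrite opprD -scalerN ffunE scaleE.
Qed.

End ReflectionPairing.

Theorem theorem3p5 (R : realType) (m n : nat) (gT : finGroupType)
    (rho : mx_representation R [set: gT] m) (B : 'M[R]_m)
    (Phi : {fset 'cV[R]_m}) (Delta : n.-tuple 'cV[R]_m) (k : 'cV[R]_m -> R[i])
    (W_refl : reflection_group rho)
    (B_inner : invariant_inner_product rho B)
    (Phi_root : root_system rho B Phi)
    (Delta_simple : simple_system Phi Delta)
    (k_inv : forall g a, a \in Phi -> k (rho g *m a) = k a) :
  let rhoC := crep rho in
  let kappa := h_kappa rho B Phi Delta k in
  let t := hT rhoC kappa in
  let tld := tilde rho B Phi Delta k in
  [/\ graded_hecke rhoC kappa,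
      forall v w, comm_br (tld v) (tld w) = 0
    & forall i v,
        let a := tnth Delta i in
        let s := refl_elt rho B a in
        t s * tld v =
          tld (rhoC s *m v) * t s - (k a * cform B v (cvec (coroot B a))) *: (1 : hecke_alg rhoC kappa)].
Proof.
move=> rhoC kappa t tld; pose f := real_complex R.
(* At this [f], [refl_sum] and [refl_bracket] are convertible to [h_pairing] and [h_kappa]. *)
have h_linear := @refl_sum_linear R R[i] f gT m n rho B Phi Delta k.
have h_sym := @refl_sum_sym R R[i] f gT m n rho B Phi Delta k
  W_refl B_inner Phi_root.
have kappaE v w : kappa v w = - comm_br (h_pairing rho B Phi Delta k v)
  (h_pairing rho B Phi Delta k w) by [].
have kappaJ := @refl_bracket_equivariant R R[i] f gT m n rho B Phi Delta k
  W_refl B_inner Phi_root Delta_simple k_inv.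
have t_h := @refl_mul_refl_sum R R[i] f gT m n rho B Phi Delta k
  W_refl B_inner Phi_root Delta_simple k_inv.
split=> [|v w|i v].
- split; first exact: (@refl_bracket_skew R R[i] f gT m n rho B Phi Delta k).
  move=> u u_basis; apply: formal_basisP => [a|c c0]; first exact: pbw_spanned.
  exact: (@pbw_coef0 _ _ _ rhoC _ kappa h_linear h_sym kappaE kappaJ u c
    u_basis c0).
- exact: shifted_comm h_sym kappaE v w.
(* The image under [hW] of [t_h], the relation already known in the group algebra; its constant term
   acquires a minus sign because [tilde] subtracts. *)
move=> a s; rewrite /tld /tilde mulrBr mulrBl hT_hW hTV t_h hWD hWZ.
by rewrite hW1 -hW_hT opprD addrA.
Qed.
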